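(* For every $n\ge 1$, the isomorphism problem for recursive trees of height at most $n$ is $\Pi^0_{2n}$-complete.
   Context: A tree is a structure $(V;\le)$ where $\le$ is a partial order with a least element such that for every $x\in V$ the set $\{y\mid y\le x\}$ is a finite linear order; the level of $x$ is $|\{y\mid y<x\}|$ and the height is the supremum of levels. A structure is recursive (computable) if its domain and all its relations are recursive sets of finite words (or natural numbers); it is given by Turing machines deciding the domain and the relations. The isomorphism problem for recursive trees of height at most $n$ is the set of pairs of such descriptions whose structures are isomorphic trees of height at most $n$. $\Pi^0_{m}$ denotes the $m$-th universal level of the arithmetical hierarchy. *)

(* Defs.v *)
From HB Require Import structures.
From mathcomp Require Import all_boot.

Set Implicit Arguments.
Unset Strict Implicit.
Unset Printing Implicit Defensive.

Inductive rfun : Type :=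
| rZero : rfun
| rSucc : rfun
| rProj : nat -> rfun
| rComp : rfun -> seq rfun -> rfun
| rPrec : rfun -> rfun -> rfun
| rMin  : rfun -> rfun.

Inductive eval : rfun -> seq nat -> nat -> Prop :=
| evZero xs : eval rZero xs 0
| evSucc xs : eval rSucc xs (head 0 xs).+1
| evProj i xs : eval (rProj i) xs (nth 0 xs i)
| evComp f gs xs ys y :
    evals gs xs ys -> eval f ys y -> eval (rComp f gs) xs y
| evPrec0 g h xs y : eval g xs y -> eval (rPrec g h) (0 :: xs) y
| evPrecS g h k xs v y :
    eval (rPrec g h) (k :: xs) v -> eval h [:: k, v & xs] y ->
    eval (rPrec g h) (k.+1 :: xs) y
| evMin f xs y :
    eval f (y :: xs) 0 ->
    (forall z, z < y -> exists v, eval f (z :: xs) v.+1) ->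
    eval (rMin f) xs y
with evals : seq rfun -> seq nat -> seq nat -> Prop :=
| evsNil xs : evals [::] xs [::]
| evsCons g gs xs y ys :
    eval g xs y -> evals gs xs ys -> evals (g :: gs) xs (y :: ys).

(* Goedel numbering of programs: rfun is made a countType by an
   (evidently primitive recursive) encoding into GenTree.tree nat. *)
Fixpoint rfun_enc (p : rfun) : GenTree.tree nat :=
  match p with
  | rZero => GenTree.Node 0 [::]
  | rSucc => GenTree.Node 1 [::]
  | rProj i => GenTree.Node 2 [:: GenTree.Leaf i]
  | rComp f gs => GenTree.Node 3 (rfun_enc f :: map rfun_enc gs)
  | rPrec f g => GenTree.Node 4 [:: rfun_enc f; rfun_enc g]
  | rMin f => GenTree.Node 5 [:: rfun_enc f]
  end.

Fixpoint rfun_dec (t : GenTree.tree nat) : option rfun :=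
  let fix decs (ts : seq (GenTree.tree nat)) : option (seq rfun) :=
    match ts with
    | [::] => Some [::]
    | t :: ts' =>
        match rfun_dec t, decs ts' with
        | Some p, Some ps => Some (p :: ps)
        | _, _ => None
        end
    end in
  match t with
  | GenTree.Node 0 [::] => Some rZero
  | GenTree.Node 1 [::] => Some rSucc
  | GenTree.Node 2 [:: GenTree.Leaf i] => Some (rProj i)
  | GenTree.Node 3 (tf :: tgs) =>
      match rfun_dec tf, decs tgs with
      | Some f, Some gs => Some (rComp f gs)
      | _, _ => None
      end
  | GenTree.Node 4 [:: tf; tg] =>
      match rfun_dec tf, rfun_dec tg with
      | Some f, Some g => Some (rPrec f g)
      | _, _ => None
      end
  | GenTree.Node 5 [:: tf] =>
      match rfun_dec tf with Some f => Some (rMin f) | None => None end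
  | _ => None
  end.

Lemma rfun_encK : pcancel rfun_enc rfun_dec.
Proof.
unfold pcancel; fix IH 1; intros p; destruct p as [| |i|f gs|f g|f]; simpl; try reflexivity.
- rewrite IH.
  assert (H : (fix decs (ts : seq (GenTree.tree nat)) : option (seq rfun) :=
      match ts with
      | [::] => Some [::]
      | t :: ts' =>
          match rfun_dec t, decs ts' with
          | Some p, Some ps => Some (p :: ps)
          | _, _ => None
          end
      end) (map rfun_enc gs) = Some gs).
  { induction gs as [|g gs IHgs]; [reflexivity|]; simpl; rewrite IH IHgs; reflexivity. }
  rewrite H; reflexivity.
- rewrite !IH; reflexivity.
- rewrite IH; reflexivity.
Qed.

HB.instance Definition _ := Countable.copy rfun (pcan_type rfun_encK).

Definition prog (e : nat) : option rfun := unpickle e.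

Definition recursive_rel (R : seq nat -> Prop) : Prop :=
  exists p : rfun, forall xs, (R xs /\ eval p xs 1) \/ (~ R xs /\ eval p xs 0).

Definition computable_fun (f : nat -> nat) : Prop :=
  exists p : rfun, forall x, eval p [:: x] (f x).

Fixpoint arith (m : nat) (sigma : bool) (R : seq nat -> Prop) : Prop :=
  match m with
  | 0 => recursive_rel R
  | m'.+1 =>
      exists S : seq nat -> Prop, arith m' (~~ sigma) S /\
        forall xs, R xs <-> (if sigma then exists y, S (y :: xs)
                             else forall y, S (y :: xs))
  end.

Definition Pi0_set (m : nat) (A : nat -> Prop) : Prop :=
  exists R, arith m false R /\ forall x, A x <-> R [:: x].

Definition m_reducible (B A : nat -> Prop) : Prop :=
  exists f, computable_fun f /\ forall x, B x <-> A (f x).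

Definition Pi0_complete (m : nat) (A : nat -> Prop) : Prop :=
  Pi0_set m A /\ forall B, Pi0_set m B -> m_reducible B A.

Definition cpair (x y : nat) : nat := ((x + y) * (x + y).+1)./2 + y.

Definition decides1 (p : rfun) (P : nat -> Prop) : Prop :=
  forall x, (P x /\ eval p [:: x] 1) \/ (~ P x /\ eval p [:: x] 0).
Definition decides2 (p : rfun) (P : nat -> nat -> Prop) : Prop :=
  forall x y, (P x y /\ eval p [:: x; y] 1) \/ (~ P x y /\ eval p [:: x; y] 0).

Definition tree_height_le (n : nat) (D : nat -> Prop) (le : nat -> nat -> Prop)
  : Prop :=
  [/\ (forall x, D x -> le x x),
      (forall x y, D x -> D y -> le x y -> le y x -> x = y),
      (forall x y z, D x -> D y -> D z -> le x y -> le y z -> le x z),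
      (exists r, D r /\ forall x, D x -> le r x) &
      (forall x, D x ->
         (forall y z, D y -> D z -> le y x -> le z x -> le y z \/ le z y) /\
         (* {y | y < x} is finite, of size (the level of x) at most n *)
         exists s : seq nat, [/\ uniq s, size s <= n &
            forall y, y \in s <-> (D y /\ le y x /\ y <> x)])].

Definition iso_structures (D1 : nat -> Prop) (le1 : nat -> nat -> Prop)
    (D2 : nat -> Prop) (le2 : nat -> nat -> Prop) : Prop :=
  exists f : nat -> nat,
    [/\ (forall x, D1 x -> D2 (f x)),
        (forall x y, D1 x -> D1 y -> f x = f y -> x = y),
        (forall z, D2 z -> exists2 x, D1 x & f x = z) &
        (forall x y, D1 x -> D1 y -> (le1 x y <-> le2 (f x) (f y)))].

Definition IsoTreeProblem (n : nat) (c : nat) : Prop :=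
  exists a1 b1 a2 b2 d1 r1 d2 r2 (D1 D2 : nat -> Prop) (le1 le2 : nat -> nat -> Prop),
    c = cpair (cpair a1 b1) (cpair a2 b2) /\
    prog a1 = Some d1 /\ prog b1 = Some r1 /\
    prog a2 = Some d2 /\ prog b2 = Some r2 /\
    decides1 d1 D1 /\ decides2 r1 le1 /\ decides1 d2 D2 /\ decides2 r2 le2 /\
    tree_height_le n D1 le1 /\ tree_height_le n D2 le2 /\
    iso_structures D1 le1 D2 le2.

(* Main.v *)
From Stdlib Require Import Classical FunctionalExtensionality PropExtensionality.
From Stdlib Require Import IndefiniteDescription.
Require Import Defs.
From mathcomp Require Import all_boot zify.

(* Membership: with T_x the subtree above x, two trees of height at most m+1 are isomorphic
   iff for every node z and every k both or neither of the roots have k children u with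
   T_u isomorphic to T_z; by induction this is Pi_(2m+2), the base being that evaluation of
   coded programs is Sigma_1 and that "being a tree of height at most n" is Pi_2.
   Hardness: a Sigma_(2m+1) set has unique witnesses in Pi_2m, so a Pi_(2m+2) statement P
   says that infinitely many w satisfy some Pi_2m statement Q w, and iterating this, P is a
   block of quantifiers "infinitely many" before a recursive statement. Its tree has one
   subtree per instance Q w, plus infinitely many copies of each tree of a false
   statement having exactly k true instances; up to isomorphism it then depends only on the
   number of true instances of P. *)

Set Implicit Arguments.
Unset Strict Implicit.
Unset Printing Implicit Defensive.

(** * Pairing *)

(** Children are counted only through the statements that there are at least [k] of them, for finite
    [k]; agreement for every [k] compares infinite numbers as well, all sets being countable. Being
    an immediate successor is Pi_1 over an order that is uniformly only Sigma_1; this is absorbed at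
    the upper levels but would spoil the count at the bottom one, whence the variant [kid]. A class
    of subtrees is named by a node, possibly of the other tree, so both trees are compared inside
    their disjoint sum. For hardness, unique witnesses leave at most one list of witnesses for 0,
    ..., y-1 for each y, so there are infinitely many such lists only if no y fails. Truth shows at
    the leaves, where a recursive statement is a node that is present or absent. *)

Definition tri (s : nat) : nat := (s * s.+1)./2.

Lemma triS s : tri s.+1 = tri s + s.+1.
Proof. by rewrite /tri; nia. Qed.

Lemma leq_tri s t : s <= t -> tri s <= tri t.
Proof.
elim: t => [|t IH]; first by case: s.
by rewrite leq_eqVlt => /orP[/eqP-> //|/IH]; rewrite triS; lia.
Qed.

Lemma leq_id_tri s : s <= tri s.
Proof. by elim: s => // s; rewrite triS; lia. Qed.

Lemma diag_ex z : exists s, z < tri s.+1.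
Proof. by exists z; have := leq_id_tri z.+1; lia. Qed.

Definition diag z := ex_minn (diag_ex z).
Definition pi2 z := z - tri (diag z).
Definition pi1 z := diag z - pi2 z.

Lemma cpairE x y : cpair x y = tri (x + y) + y.
Proof. by []. Qed.

Lemma diagP z : tri (diag z) <= z < tri (diag z).+1.
Proof.
rewrite /diag; case: ex_minnP => s lt_s min_s; rewrite lt_s andbT.
by case: s lt_s min_s => // s _ min_s; rewrite leqNgt; apply/negP => /min_s; lia.
Qed.

Lemma diag_uniq z s : tri s <= z < tri s.+1 -> diag z = s.
Proof.
move=> /andP[le1 lt1]; have /andP[le2 lt2] := diagP z.
apply/eqP; rewrite eqn_leq; apply/andP; split; rewrite leqNgt; apply/negP => /leq_tri; lia.
Qed.

Lemma diag_cpair x y : diag (cpair x y) = x + y.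
Proof. by apply: diag_uniq; rewrite cpairE triS; lia. Qed.

Lemma pi2_cpair x y : pi2 (cpair x y) = y.
Proof. by rewrite /pi2 diag_cpair cpairE; lia. Qed.

Lemma pi1_cpair x y : pi1 (cpair x y) = x.
Proof. by rewrite /pi1 pi2_cpair diag_cpair; lia. Qed.

Definition pi_cpairE := (pi1_cpair, pi2_cpair).

Lemma cpair_pi z : cpair (pi1 z) (pi2 z) = z.
Proof.
have /andP[] := diagP z; rewrite triS cpairE => le1 lt1.
have -> : pi1 z + pi2 z = diag z by rewrite /pi1 /pi2; lia.
by rewrite /pi2; lia.
Qed.

Lemma cpair_inj x y x' y' : cpair x y = cpair x' y' -> x = x' /\ y = y'.
Proof.
by move=> e; rewrite -(pi1_cpair x y) -{2}(pi2_cpair x y) e !pi_cpairE.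
Qed.

Lemma leq_pi1 z : pi1 z <= z.
Proof. by rewrite -{2}(cpair_pi z) cpairE; have := leq_id_tri (pi1 z + pi2 z); lia. Qed.

Lemma leq_pi2 z : pi2 z <= z.
Proof. by rewrite -{2}(cpair_pi z) cpairE; lia. Qed.

Lemma pi10 : pi1 0 = 0. Proof. by have := leq_pi1 0; lia. Qed.
Lemma pi20 : pi2 0 = 0. Proof. by have := leq_pi2 0; lia. Qed.

Arguments cpair : simpl never.
Arguments pi1 : simpl never.
Arguments pi2 : simpl never.

(** * Computable functions and recursive predicates *)

Notation cfun := computable_fun.

Definition comp2 (f : nat -> nat -> nat) : Prop :=
  exists p, forall x y, eval p [:: x; y] (f x y).

Lemma eval_comp1 f g xs y z : eval g xs y -> eval f [:: y] z -> eval (rComp f [:: g]) xs z.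
Proof. by move=> eg ef; apply: evComp ef; apply: evsCons => //; apply: evsNil. Qed.

Lemma eval_comp2 f g h xs y y' z : eval g xs y -> eval h xs y' ->
  eval f [:: y; y'] z -> eval (rComp f [:: g; h]) xs z.
Proof.
by move=> eg eh ef; apply: evComp ef; do 2!apply: evsCons => //; apply: evsNil.
Qed.

Lemma eval_proj i xs y : nth 0 xs i = y -> eval (rProj i) xs y.
Proof. by move<-; apply: evProj. Qed.

Lemma eval_succ g xs y z : eval g xs y -> z = y.+1 -> eval (rComp rSucc [:: g]) xs z.
Proof. by move=> eg ->; apply: eval_comp1 eg _; apply: evSucc. Qed.

Lemma comp_ext f g : cfun f -> f =1 g -> cfun g.
Proof. by move=> [p Hp] e; exists p => x; rewrite -e. Qed.

Lemma comp_id : cfun (fun x => x).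
Proof. by exists (rProj 0) => x; apply: eval_proj. Qed.

Lemma comp_comp f g : cfun f -> cfun g -> cfun (fun x => f (g x)).
Proof. by move=> [p Hp] [q Hq]; exists (rComp p [:: q]) => x; apply: eval_comp1 (Hq x) _. Qed.

Lemma comp_S f : cfun f -> cfun (fun x => (f x).+1).
Proof. by move=> [p Hp]; exists (rComp rSucc [:: p]) => x; apply: eval_succ (Hp x) _. Qed.

Lemma comp_const k : cfun (fun=> k).
Proof.
elim: k => [|k IH]; last exact: comp_S.
by exists rZero => x; apply: evZero.
Qed.

Lemma comp_comp2 f g h : comp2 f -> cfun g -> cfun h -> cfun (fun x => f (g x) (h x)).
Proof.
move=> [p Hp] [q Hq] [r Hr]; exists (rComp p [:: q; r]) => x.
by apply: eval_comp2 (Hq x) (Hr x) _.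
Qed.

Lemma comp2_swap f : comp2 f -> comp2 (fun x y => f y x).
Proof.
move=> [p Hp]; exists (rComp p [:: rProj 1; rProj 0]) => x y.
by apply: eval_comp2 (Hp y x); apply: eval_proj.
Qed.

Lemma comp2_addn : comp2 addn.
Proof.
exists (rPrec (rProj 0) (rComp rSucc [:: rProj 1])) => x y.
elim: x => [|x IH]; first by apply: evPrec0; apply: eval_proj.
by apply: evPrecS IH _; apply: eval_succ (eval_proj _) _.
Qed.

Lemma comp_addn f g : cfun f -> cfun g -> cfun (fun x => f x + g x).
Proof. exact: comp_comp2 comp2_addn. Qed.

Lemma comp2_iter F : cfun F -> comp2 (fun k x => iter k F x).
Proof.
case=> p Hp; exists (rPrec (rProj 0) (rComp p [:: rProj 1])) => k x.
elim: k => [|k IH]; first by apply: evPrec0; apply: eval_proj.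
by apply: evPrecS IH _; apply: eval_comp1 (Hp _); apply: eval_proj.
Qed.

Lemma comp_iter F f g : cfun F -> cfun f -> cfun g -> cfun (fun x => iter (f x) F (g x)).
Proof. by move/comp2_iter; apply: comp_comp2. Qed.

Lemma comp_predn f : cfun f -> cfun (fun x => (f x).-1).
Proof.
apply: (comp_comp (f := predn)).
exists (rPrec rZero (rProj 0)) => k.
elim: k => [|k IH]; first by apply: evPrec0; apply: evZero.
by apply: evPrecS IH _; apply: eval_proj.
Qed.

Lemma comp_subn f g : cfun f -> cfun g -> cfun (fun x => f x - g x).
Proof.
move=> cf cg; apply: comp_ext (comp_iter (comp_predn comp_id) cg cf) _ => x.
by elim: (g x) => [|k /= ->]; rewrite ?subn0 ?subnS.
Qed.

Lemma comp2_muln : comp2 muln.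
Proof.
have [p Hp] := comp2_addn.
exists (rPrec rZero (rComp p [:: rProj 2; rProj 1])) => x y.
elim: x => [|x IH]; first by apply: evPrec0; apply: evZero.
by apply: evPrecS IH _; apply: eval_comp2 (Hp _ _); apply: eval_proj.
Qed.

Lemma comp_muln f g : cfun f -> cfun g -> cfun (fun x => f x * g x).
Proof. exact: comp_comp2 comp2_muln. Qed.

Lemma comp_exp2 f : cfun f -> cfun (fun x => 2 ^ f x).
Proof.
move=> cf; apply: comp_ext (comp_iter (comp_addn comp_id comp_id) cf (comp_const 1)) _ => x.
by elim: (f x) => [|k /= ->] //; rewrite expnS mul2n addnn.
Qed.

Lemma comp_tri f : cfun f -> cfun (fun x => tri (f x)).
Proof.
apply: (comp_comp (f := tri)).
have [p Hp] := comp2_addn.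
exists (rPrec rZero (rComp p [:: rProj 1; rComp rSucc [:: rProj 0]])) => x.
elim: x => [|x IH]; first by apply: evPrec0; apply: evZero.
apply: evPrecS IH _; rewrite triS; apply: eval_comp2 (Hp _ _); first exact: eval_proj.
by apply: eval_succ (eval_proj _) _.
Qed.

Lemma comp_min2 f g : comp2 f ->
  (forall x, f (g x) x = 0 /\ forall z, z < g x -> f z x <> 0) -> cfun g.
Proof.
move=> [p Hp] Hg; exists (rMin p) => x; have [g0 gmin] := Hg x.
apply: evMin => [|z /gmin nz]; first by have := Hp (g x) x; rewrite g0.
by exists (f z x).-1; have := Hp z x; case: (f z x) nz.
Qed.

Lemma comp_cpair f g : cfun f -> cfun g -> cfun (fun x => cpair (f x) (g x)).
Proof.
by move=> cf cg; apply: (comp_addn (comp_tri (comp_addn cf cg)) cg).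
Qed.

Lemma comp2_cpair : comp2 cpair.
Proof.
have [a Ha] := comp2_addn; have [t Ht] := comp_tri comp_id.
exists (rComp a [:: rComp t [:: a]; rProj 1]) => x y.
apply: eval_comp2 (Ha _ _); last exact: eval_proj.
exact: eval_comp1 (Ha x y) (Ht _).
Qed.

Lemma comp_diag : cfun diag.
Proof.
(* [f s z] vanishes exactly when [z < tri s.+1], the condition whose least solution is [diag z]. *)
pose f s z := z.+1 - tri s.+1.
apply: (@comp_min2 f) => [|z].
  have [t Ht] := comp_tri (comp_S comp_id).
  have [p Hp] : comp2 subn.
    have [q Hq] := comp2_swap (comp2_iter (comp_predn comp_id)).
    exists q => x y; have -> : x - y = iter y predn x by elim: y => [|y /= <-]; rewrite ?subn0 ?subnS.
    exact: Hq.
  exists (rComp p [:: rComp rSucc [:: rProj 1]; rComp t [:: rProj 0]]) => x y.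
  apply: eval_comp2 (Hp _ _); first by apply: eval_succ (eval_proj _) _.
  by apply: eval_comp1 (Ht _); apply: eval_proj.
rewrite /f; have /andP[le1 lt1] := diagP z; split; first by lia.
by move=> t lt_t; have := leq_tri lt_t; lia.
Qed.

Lemma comp_pi2 f : cfun f -> cfun (fun x => pi2 (f x)).
Proof.
by move=> cf; apply: (comp_comp _ cf); apply: comp_subn comp_id (comp_tri comp_diag).
Qed.

Lemma comp_pi1 f : cfun f -> cfun (fun x => pi1 (f x)).
Proof.
by move=> cf; apply: (comp_comp _ cf); apply: comp_subn comp_diag (comp_pi2 comp_id).
Qed.

Lemma comp_uncurry f : comp2 f <-> cfun (fun c => f (pi1 c) (pi2 c)).
Proof.
split=> [cf|[p Hp]]; first by apply: comp_comp2 cf _ _; [apply: comp_pi1 comp_id|apply: comp_pi2 comp_id].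
have [q Hq] := comp2_cpair; exists (rComp p [:: q]) => x y.
by apply: eval_comp1 (Hq x y) _; have := Hp (cpair x y); rewrite !pi_cpairE.
Qed.

Lemma comp_min f g : cfun f ->
  (forall x, f (cpair (g x) x) = 0 /\ forall z, z < g x -> f (cpair z x) <> 0) -> cfun g.
Proof.
move=> cf Hg; apply: (@comp_min2 (fun z x => f (cpair z x))) => //.
by apply/comp_uncurry; apply: (comp_comp cf); apply: comp_cpair; [apply: comp_pi1 comp_id|apply: comp_pi2 comp_id].
Qed.

Ltac comp_step := lazymatch goal with
  | |- computable_fun (fun x => x) => exact: comp_id
  | |- computable_fun (fun x => S _) => apply: comp_S
  | |- computable_fun (fun x => predn _) => apply: comp_predn
  | |- computable_fun (fun x => addn _ _) => apply: comp_addn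
  | |- computable_fun (fun x => subn _ _) => apply: comp_subn
  | |- computable_fun (fun x => muln _ _) => apply: comp_muln
  | |- computable_fun (fun x => expn 2 _) => apply: comp_exp2
  | |- computable_fun (fun x => cpair _ _) => apply: comp_cpair
  | |- computable_fun (fun x => pi1 _) => apply: comp_pi1
  | |- computable_fun (fun x => pi2 _) => apply: comp_pi2
  | |- computable_fun pi1 => exact: (comp_pi1 comp_id)
  | |- computable_fun pi2 => exact: (comp_pi2 comp_id)
  | |- computable_fun S => exact: (comp_S comp_id)
  | H : computable_fun ?f |- computable_fun (fun x => ?f _) => apply: (comp_comp H)
  | H : computable_fun ?f |- computable_fun ?f => exact: H
  | |- computable_fun _ => exact: comp_const
  end.
Ltac comp_tac := repeat comp_step.

(** Truth is the value 0: conjunction is then a sum, comparison a truncated subtraction, and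
    minimisation searches for truth. *)
Definition recp (P : nat -> Prop) : Prop :=
  exists f, cfun f /\ forall x, P x <-> f x = 0.

Lemma recp_ext P P' : recp P -> (forall x, P x <-> P' x) -> recp P'.
Proof. by move=> [f [cf Hf]] e; exists f; split=> // x; rewrite -e. Qed.

Lemma recp_sub P f : recp P -> cfun f -> recp (fun x => P (f x)).
Proof. by move=> [g [cg Hg]] cf; exists (fun x => g (f x)); split=> [|x]; [comp_tac|exact: Hg]. Qed.

Lemma recp_not P : recp P -> recp (fun x => ~ P x).
Proof.
move=> [f [cf Hf]]; exists (fun x => 1 - f x); split=> [|x]; first by comp_tac.
by rewrite Hf; case: (f x) => [|k]; split; lia.
Qed.

Lemma recp_and P Q : recp P -> recp Q -> recp (fun x => P x /\ Q x).
Proof.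
move=> [f [cf Hf]] [g [cg Hg]]; exists (fun x => f x + g x); split=> [|x]; first by comp_tac.
by rewrite Hf Hg; lia.
Qed.

Lemma recp_leq f g : cfun f -> cfun g -> recp (fun x => f x <= g x).
Proof.
move=> cf cg; exists (fun x => f x - g x); split=> [|x]; first by comp_tac.
by lia.
Qed.

Lemma recp_eq f g : cfun f -> cfun g -> recp (fun x => f x = g x).
Proof.
move=> cf cg; apply: recp_ext (recp_and (recp_leq cf cg) (recp_leq cg cf)) _ => x.
by lia.
Qed.

Lemma recp_ball P b : recp P -> cfun b -> recp (fun x => forall i, i < b x -> P (cpair i x)).
Proof.
move=> [f [cf Hf]] cb.
(* The search stops at the first failure of [P] or at the bound, so it is total; no failure lies
   below [b x] exactly when the search reaches the bound. *)
have ex_g x : exists i, (f (cpair i x) != 0) || (b x <= i) by exists (b x); rewrite leqnn orbT.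
pose g x := ex_minn (ex_g x).
have cg : cfun g.
  pose F c := (1 - f c) * (b (pi2 c) - pi1 c).
  have cF : cfun F by rewrite /F; comp_tac.
  apply: (comp_min cF) => x; rewrite /g; case: ex_minnP => i Hi min_i; rewrite /F !pi_cpairE; split.
    by case/orP: Hi => [|le_i]; [case: (f _) => // k _; nia|nia].
  move=> z lt_z; have : ~ ((f (cpair z x) != 0) || (b x <= z)) by move/min_i; lia.
  by move=> /negP; rewrite negb_or negbK => /andP[/eqP-> ]; rewrite -ltnNge !pi_cpairE; lia.
exists (fun x => b x - g x); split=> [|x]; first by comp_tac.
rewrite /g; case: ex_minnP => i Hi min_i; split=> [allP|le_i z lt_z].
  case/orP: Hi => [nz|]; last by rewrite -subn_eq0 => /eqP.
  by case: (ltnP i (b x)) => [/allP/Hf e|le_i]; [rewrite e in nz | apply/eqP; rewrite subn_eq0].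
rewrite Hf; apply/eqP; apply/negPn/negP => nz.
have : i <= z by apply: min_i; rewrite nz.
lia.
Qed.

(** * Coded lists *)

Definition lcons (a l : nat) : nat := (cpair a l).+1.
Definition lc (xs : seq nat) : nat := foldr lcons 0 xs.
Definition lhd (l : nat) : nat := pi1 l.-1.
Definition ltl (l : nat) : nat := pi2 l.-1.
Definition ldrop (l i : nat) : nat := iter i ltl l.
Definition lnth (l i : nat) : nat := lhd (ldrop l i).
(** A bounded existential in the form to which [recp_ball] applies. The code [l] itself serves as
    bound, since it is at least the length ([leq_size_lc]); [ldrop l i <> 0] says that position [i]
    exists, as [lnth] has the default value 0. *)
Definition lmem (b l : nat) : Prop :=
  ~ forall i, i < l -> ~ (ldrop l i <> 0 /\ lnth l i = b).

Lemma lhd_cons a l : lhd (lcons a l) = a. Proof. by rewrite /lhd /= pi_cpairE. Qed.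
Lemma ltl_cons a l : ltl (lcons a l) = l. Proof. by rewrite /ltl /= pi_cpairE. Qed.

Lemma lcons_inj a l a' l' : lcons a l = lcons a' l' -> a = a' /\ l = l'.
Proof. by case=> /cpair_inj. Qed.

Lemma lcons_split l : l <> 0 -> l = lcons (lhd l) (ltl l).
Proof. by case: l => // l _; rewrite /lcons /lhd /ltl cpair_pi. Qed.

Lemma ltl_lt l : l <> 0 -> ltl l < l.
Proof. by case: l => // l _; rewrite /ltl ltnS leq_pi2. Qed.

Lemma lc_surj l : exists xs, l = lc xs.
Proof.
have [k] := ubnP l; elim: k l => // k IH [|l] le_l; first by exists [::].
have [|xs e] := IH (ltl l.+1); first by apply: leq_trans (ltl_lt _) _.
by exists (lhd l.+1 :: xs); rewrite /= -e -lcons_split.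
Qed.

Lemma lc_inj : injective lc.
Proof.
elim=> [|x xs IH] [|y ys] // /lcons_inj[-> /IH->//].
Qed.

Lemma ldrop0 i : ldrop 0 i = 0.
Proof. by elim: i => //= i ->; rewrite /ltl pi20. Qed.

Lemma ldropS l i : ldrop l i.+1 = ldrop (ltl l) i.
Proof. by rewrite /ldrop iterSr. Qed.

Lemma ldrop_lc xs i : ldrop (lc xs) i = lc (drop i xs).
Proof.
elim: xs i => [|x xs IH] [|i] //=; first by rewrite -[LHS]/(ldrop 0 i.+1) ldrop0.
by rewrite -[LHS]/(ldrop (lcons x (lc xs)) i.+1) ldropS ltl_cons IH.
Qed.

Lemma lnth_lc xs i : lnth (lc xs) i = nth 0 xs i.
Proof.
rewrite /lnth ldrop_lc; elim: xs i => [|x xs IH] [|i] //=; rewrite ?lhd_cons //.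
by rewrite /lhd pi10.
by rewrite /lhd pi10.
Qed.

Lemma lc_eq0 xs : lc xs = 0 <-> xs = [::].
Proof. by case: xs. Qed.

Lemma ldrop_neq0 xs i : ldrop (lc xs) i <> 0 <-> i < size xs.
Proof.
rewrite ldrop_lc lc_eq0; split=> [|lt_i /(congr1 size)]; last by rewrite size_drop /=; lia.
by case: ltnP => // le_i []; rewrite drop_oversize.
Qed.

Lemma leq_size_lc xs : size xs <= lc xs.
Proof. by elim: xs => //= x xs IH; rewrite /lcons cpairE; lia. Qed.

Lemma lmemP b xs : lmem b (lc xs) <-> b \in xs.
Proof.
split=> [H|b_xs allN].
  apply/negPn/negP => nb; apply: H => i _; rewrite ldrop_neq0 lnth_lc => -[lt_i e].
  by rewrite -e mem_nth in nb.
apply: (allN (index b xs)).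
  by apply: leq_trans (leq_size_lc xs); rewrite index_mem.
by rewrite ldrop_neq0 lnth_lc index_mem nth_index.
Qed.

Lemma comp_lcons f g : cfun f -> cfun g -> cfun (fun x => lcons (f x) (g x)).
Proof. by move=> cf cg; rewrite /lcons; comp_tac. Qed.

Lemma comp_lhd f : cfun f -> cfun (fun x => lhd (f x)).
Proof. by move=> cf; rewrite /lhd; comp_tac. Qed.

Lemma comp_ltl f : cfun f -> cfun (fun x => ltl (f x)).
Proof. by move=> cf; rewrite /ltl; comp_tac. Qed.

Lemma comp_ldrop f g : cfun f -> cfun g -> cfun (fun x => ldrop (f x) (g x)).
Proof. by move=> cf cg; rewrite /ldrop; apply: comp_iter; first exact: comp_ltl comp_id. Qed.

Lemma comp_lnth f g : cfun f -> cfun g -> cfun (fun x => lnth (f x) (g x)).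
Proof. by move=> cf cg; apply: comp_lhd (comp_ldrop _ _). Qed.

Ltac comp_list_tac := repeat lazymatch goal with
  | |- computable_fun (fun x => lcons _ _) => apply: comp_lcons
  | |- computable_fun (fun x => lhd _) => apply: comp_lhd
  | |- computable_fun (fun x => ltl _) => apply: comp_ltl
  | |- computable_fun (fun x => ldrop _ _) => apply: comp_ldrop
  | |- computable_fun (fun x => lnth _ _) => apply: comp_lnth
  | |- _ => comp_step
  end.

(** * The arithmetical hierarchy on sets of numbers *)

(** The hierarchy of [arith] with all arguments packed into one number, so that substitution is
    composition with a single computable function. *)
Fixpoint ar (m : nat) (s : bool) (P : nat -> Prop) : Prop :=
  match m with
  | 0 => recp P
  | m'.+1 => exists Q, ar m' (~~ s) Q /\
      forall x, P x <-> (if s then exists y, Q (cpair y x) else forall y, Q (cpair y x))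
  end.

Lemma ar_ext m s P P' : ar m s P -> (forall x, P x <-> P' x) -> ar m s P'.
Proof.
case: m => [|m] /=; first exact: recp_ext.
by move=> [Q [aQ HQ]] e; exists Q; split=> // x; rewrite -e.
Qed.

Lemma ar_sub m s P f : cfun f -> ar m s P -> ar m s (fun x => P (f x)).
Proof.
elim: m s P f => [|m IH] s P f cf /=; first by move/recp_sub; apply.
move=> [Q [aQ HQ]]; exists (fun c => Q (cpair (pi1 c) (f (pi2 c)))); split.
  by apply: (IH _ _ (fun c => cpair (pi1 c) (f (pi2 c)))) => //; comp_tac.
move=> x; rewrite HQ; case: s {aQ HQ}; split=> H.
- by have [y Hy] := H; exists y; rewrite !pi_cpairE.
- by have [y Hy] := H; exists y; move: Hy; rewrite !pi_cpairE.
- by move=> y; rewrite !pi_cpairE.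
- by move=> y; have := H y; rewrite !pi_cpairE.
Qed.

Lemma ar_not m s P : ar m s P -> ar m (~~ s) (fun x => ~ P x).
Proof.
elim: m s P => [|m IH] s P /=; first exact: recp_not.
move=> [Q [/IH aQ HQ]]; exists (fun x => ~ Q x); split=> // x; rewrite HQ.
case: s {aQ HQ IH} => /=; split.
- by move=> H y Hy; apply: H; exists y.
- by move=> H [y /(H y)].
- exact: not_all_ex_not.
- by move=> [y nQ] /(_ y).
Qed.

Lemma ar_neg m s P : ar m (~~ s) P -> ar m s (fun x => ~ P x).
Proof. by move/ar_not; rewrite negbK. Qed.

Lemma dummy_quantifier s P x :
  P x <-> (if s then exists y, P (pi2 (cpair y x)) else forall y, P (pi2 (cpair y x))).
Proof.
case: s; split=> [Px|].
- by exists 0; rewrite pi_cpairE.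
- by case=> y; rewrite pi_cpairE.
- by move=> y; rewrite pi_cpairE.
- by move/(_ 0); rewrite pi_cpairE.
Qed.

(** A dummy quantifier goes in front if the new leading kind differs from the old one, and at the
    innermost place otherwise; hence the induction. *)
Lemma ar_S m s s' P : ar m s P -> ar m.+1 s' P.
Proof.
elim: m s s' P => [|m IH] s s' P.
  move=> rP; exists (fun c => P (pi2 c)); split; last exact: dummy_quantifier.
  by apply: (recp_sub rP); comp_tac.
have [->|ne] := eqVneq s' s.
  by move=> [Q [aQ HQ]]; exists Q; split=> //; apply: IH aQ.
have -> : s' = ~~ s by case: s s' ne => [] [].
move=> aP; exists (fun c => P (pi2 c)); rewrite negbK; split; last exact: dummy_quantifier.
by apply: (ar_sub _ aP); comp_tac.
Qed.

Lemma ar_lift m s m' s' P : m < m' -> ar m s P -> ar m' s' P.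
Proof.
elim: m' s' => // m' IH s'; rewrite ltnS leq_eqVlt => /orP[/eqP<-|lt_m]; first exact: ar_S.
by move=> /(IH s' lt_m)/ar_S.
Qed.

Lemma ar_recp m s P : recp P -> ar m s P.
Proof. by case: m => // m; apply: (@ar_lift 0 true). Qed.

Lemma ar_and m s P Q : ar m s P -> ar m s Q -> ar m s (fun x => P x /\ Q x).
Proof.
elim: m s P Q => [|m IH] s P Q /=; first exact: recp_and.
move=> [P' [aP HP]] [Q' [aQ HQ]]; case: s aP aQ HP HQ => aP aQ HP HQ.
- exists (fun c => P' (cpair (pi1 (pi1 c)) (pi2 c)) /\ Q' (cpair (pi2 (pi1 c)) (pi2 c))); split.
    by apply: IH; [apply: (ar_sub _ aP)|apply: (ar_sub _ aQ)]; comp_tac.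
  move=> x; rewrite HP HQ; split=> [[[y Py] [z Qz]]|[y [Py Qz]]].
    by exists (cpair y z); rewrite !pi_cpairE.
  by rewrite !pi_cpairE in Py Qz; split; [exists (pi1 y)|exists (pi2 y)].
- exists (fun c => P' c /\ Q' c); split; first exact: IH.
  by move=> x; rewrite HP HQ; split=> [[PH QH] y|H]; [|split=> y; have [] := H y].
Qed.

Lemma ar_or m s P Q : ar m s P -> ar m s Q -> ar m s (fun x => P x \/ Q x).
Proof.
move=> /ar_not aP /ar_not aQ; apply: ar_ext (ar_neg (ar_and aP aQ)) _ => x.
by split=> [/not_and_or[/NNPP|/NNPP]|[]]; tauto.
Qed.

Lemma ar_imp m s P Q : ar m (~~ s) P -> ar m s Q -> ar m s (fun x => P x -> Q x).
Proof.
move=> /ar_neg aP aQ; apply: ar_ext (ar_or aP aQ) _ => x.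
by split=> [[]|H]; [tauto..|have [|] := classic (P x); tauto].
Qed.

Lemma ar_iff m s m' s' P Q : m < m' -> ar m s P -> ar m s Q -> ar m' s' (fun x => P x <-> Q x).
Proof.
by move=> lt_m aP aQ; apply: ar_and; apply: ar_imp; apply: ar_lift lt_m _; eassumption.
Qed.

Lemma ar_ex m P : ar m.+1 true (fun c => P (pi1 c) (pi2 c)) -> ar m.+1 true (fun x => exists y, P y x).
Proof.
move=> [Q [aQ HQ]].
exists (fun c => Q (cpair (pi1 (pi1 c)) (cpair (pi2 (pi1 c)) (pi2 c)))); split.
  by apply: (ar_sub _ aQ); comp_tac.
move=> x; split=> [[y Py]|[w]].
  have [w Hw] : exists w, Q (cpair w (cpair y x)) by apply/HQ; rewrite !pi_cpairE.
  by exists (cpair w y); rewrite !pi_cpairE.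
rewrite !pi_cpairE => Hw; exists (pi2 w).
by have := HQ (cpair (pi2 w) x); rewrite !pi_cpairE => ->; exists (pi1 w).
Qed.

Lemma ar_all m P : ar m.+1 false (fun c => P (pi1 c) (pi2 c)) -> ar m.+1 false (fun x => forall y, P y x).
Proof.
move=> /ar_not aP; have := ar_neg (s := false) (ar_ex (P := fun y x => ~ P y x) aP).
move/ar_ext; apply=> x; split=> [H y|H [y []]//].
by apply: NNPP => nP; apply: H; exists y.
Qed.

Lemma ar_eq m s f g : cfun f -> cfun g -> ar m s (fun x => f x = g x).
Proof. by move=> cf cg; apply: ar_recp; apply: recp_eq. Qed.

Lemma ar_leq m s f g : cfun f -> cfun g -> ar m s (fun x => f x <= g x).
Proof. by move=> cf cg; apply: ar_recp; apply: recp_leq. Qed.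

(** Bounded universal quantifiers cost no alternation: at a Pi level the leading universal
    quantifier absorbs them, and at level 0 a bounded search decides them. *)
Lemma ar_ball m s P b : cfun b -> ar m s (fun c => P (pi1 c) (pi2 c)) ->
  ar m s (fun x => forall i, i < b x -> P i x).
Proof.
have Pi k R b' : cfun b' -> ar k false R ->
    ar k false (fun x => forall i, i < b' x -> R (cpair i x)).
  move=> cb'; case: k => [|k] aR; first exact: recp_ball.
  apply: (@ar_all _ (fun i x => i < b' x -> R (cpair i x))); apply: ar_imp.
    by apply: ar_leq; comp_tac.
  by apply: ar_ext aR _ => c; rewrite cpair_pi.
move=> cb; case: m s => [|m] [] aP.
- by apply: ar_ext (Pi 0 _ _ cb aP) _ => x; split=> H i /H; rewrite !pi_cpairE.
- by apply: ar_ext (Pi 0 _ _ cb aP) _ => x; split=> H i /H; rewrite !pi_cpairE.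
- (* collection: the witnesses for all [i < b x] are gathered in one list *)
  have [Q [aQ HQ]] := aP.
  exists (fun c => forall i, i < b (pi2 c) ->
    Q (cpair (lnth (pi1 (pi2 (cpair i c))) (pi1 (cpair i c))) (cpair (pi1 (cpair i c)) (pi2 (pi2 (cpair i c)))))); split.
    pose R c := Q (cpair (lnth (pi1 (pi2 c)) (pi1 c)) (cpair (pi1 c) (pi2 (pi2 c)))).
    apply: (Pi _ R (fun c => b (pi2 c))); first by comp_tac.
    by apply: (ar_sub _ aQ); comp_list_tac.
  move=> x; split=> [H|[W HW] i lt_i].
    have /functional_choice[w Hw] : forall i, exists w, i < b x -> Q (cpair w (cpair i x)).
      move=> i; case: (ltnP i (b x)) => [lt_i|]; last by exists 0.
      have Pi_x : P (pi1 (cpair i x)) (pi2 (cpair i x)) by rewrite !pi_cpairE; apply: H.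
      by have [w Hw] := (HQ _).1 Pi_x; exists w.
    exists (lc (mkseq w (b x))) => i; rewrite !pi_cpairE => lt_i.
    by rewrite lnth_lc nth_mkseq //; apply: Hw.
  have := HQ (cpair i x); rewrite !pi_cpairE => ->; exists (lnth W i).
  by have := HW i; rewrite !pi_cpairE; apply.
- by apply: ar_ext (Pi _ _ _ cb aP) _ => x; split=> H i /H; rewrite !pi_cpairE.
Qed.

Lemma ar_lmem m s f g : cfun f -> cfun g -> ar m s (fun x => lmem (f x) (g x)).
Proof.
move=> cf cg; apply: ar_recp; rewrite /lmem; apply: recp_not.
apply: (@ar_ball 0 true (fun i x => ~ (ldrop (g x) i <> 0 /\ lnth (g x) i = f x))) => //.
by apply: recp_not; apply: recp_and; [apply: recp_not|]; apply: recp_eq; comp_list_tac.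
Qed.

Arguments ar : simpl never.

Ltac ar_step := lazymatch goal with
  | |- ar _ _ (fun x => _ /\ _) => apply: ar_and
  | |- ar _ _ (fun x => _ \/ _) => apply: ar_or
  | |- ar _ _ (fun x => ~ _) => apply: ar_neg; cbn [negb]
  | |- ar _ _ (fun x => @eq nat _ _) => apply: ar_eq; comp_list_tac
  | |- ar _ _ (fun x => is_true (leq _ _)) => apply: ar_leq; comp_list_tac
  | |- ar _ _ (fun x => lmem _ _) => apply: ar_lmem; comp_list_tac
  | |- ar _ true (fun x => exists y, _) => apply: ar_ex
  | |- ar _ _ (fun x => forall y, is_true (leq (S y) _) -> _) => apply: ar_ball; comp_list_tac
  | |- ar _ false (fun x => forall y : nat, _) => apply: ar_all
  | |- ar _ _ (fun x => _ -> _) => apply: ar_imp; cbn [negb]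
  | H : ar ?m ?s ?P |- ar ?m ?s (fun x => ?P _) => apply: (ar_sub _ H); comp_list_tac
  | H : ar ?m ?s ?P |- ar ?m ?s ?P => exact: H
  end.
Ltac ar_tac := repeat ar_step.

(** * Inductive definitions with Sigma_1 rules *)

(** The least set closed under the rules [J l a], with [l] the coded list of premises. Evaluation,
    well-formedness of programs and the parsing of Goedel numbers are all instances, and [ar_Der]
    makes them Sigma_1 at once. *)
Inductive Der (J : nat -> nat -> Prop) (a : nat) : Prop :=
  DerI l of (forall b, lmem b l -> Der J b) & J l a.

(** A finite certificate for [Der]: each entry follows by a rule from entries to its right. *)
Fixpoint derivation (J : nat -> nat -> Prop) (ws : seq nat) : Prop :=
  if ws is w :: ws' then
    derivation J ws' /\ exists2 ls, J (lc ls) w & {subset ls <= ws'}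
  else True.

Lemma derivation_cat J ws ws' : derivation J ws -> derivation J ws' -> derivation J (ws ++ ws').
Proof.
elim: ws => //= w ws IH [dws [ls Jw sub]] dws'; split; first exact: IH.
by exists ls => // x /sub; rewrite mem_cat => ->.
Qed.

Lemma derivation_Der J ws a : derivation J ws -> a \in ws -> Der J a.
Proof.
elim: ws a => //= w ws IH a [dws [ls Jw sub]]; rewrite inE => /orP[/eqP->|/(IH a dws)//].
by apply: (DerI (l := lc ls)) => // b /lmemP/sub/(IH b dws).
Qed.

Lemma Der_derivation J a : Der J a -> exists2 ws, derivation J ws & a \in ws.
Proof.
elim=> {}a l _ IH Ja; have [ls e] := lc_surj l; rewrite e in IH Ja.
have [ws dws sub] : exists2 ws, derivation J ws & {subset ls <= ws}.
  have {}IH : forall b, b \in ls -> exists2 ws, derivation J ws & b \in ws by move=> b /lmemP/IH.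
  elim: (ls) IH => [|b bs IHb] IH; first by exists [::].
  have [|ws dws sub] := IHb; first by move=> c cbs; apply: IH; rewrite inE cbs orbT.
  have [|ws' dws' b_ws'] := IH b; first by rewrite inE eqxx.
  exists (ws' ++ ws); first exact: derivation_cat.
  by move=> c; rewrite inE mem_cat => /orP[/eqP->|/sub->]; rewrite ?b_ws' ?orbT.
by exists (a :: ws); [split=> //; exists ls|rewrite inE eqxx].
Qed.

(** Certificates in terms of coded lists, with all positions bounded by codes instead of lengths, so
    that only the existential choice of [l] and the rule [J] are not decidable. *)
Lemma derivationE J ws : derivation J ws <->
  forall i, i < lc ws -> ldrop (lc ws) i <> 0 -> exists l, J l (lnth (lc ws) i) /\
    forall j, j < l -> ldrop l j <> 0 -> lmem (lnth l j) (ldrop (lc ws) i.+1).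
Proof.
transitivity (forall i, i < size ws ->
  exists2 ls, J (lc ls) (nth 0 ws i) & {subset ls <= drop i.+1 ws}).
  elim: ws => //= w ws IH; rewrite IH; split=> [[H Hw] [|i]|H].
  - by rewrite drop0.
  - exact: H.
  - by split=> [i|]; [have := H i.+1|have := H 0 isT; rewrite drop0].
split=> H i.
  rewrite ldrop_neq0 => _ /H[ls Jl sub]; exists (lc ls); rewrite lnth_lc; split=> // j _.
  by rewrite ldrop_neq0 lnth_lc ldrop_lc => lt_j; apply/lmemP/sub/mem_nth.
move=> lt_i; have [||l []] := H i; [exact: leq_trans lt_i (leq_size_lc _)|exact/ldrop_neq0|].
have [ls ->] := lc_surj l; rewrite lnth_lc => Jl sub; exists ls => // b b_ls.
have := sub (index b ls); rewrite ldrop_neq0 lnth_lc ldrop_lc index_mem nth_index // => /(_ _ b_ls)/lmemP.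
by apply; apply: leq_trans (leq_size_lc ls); rewrite index_mem.
Qed.

Lemma ar_Der J : ar 1 true (fun c => J (pi1 c) (pi2 c)) -> ar 1 true (Der J).
Proof.
move=> aJ.
apply: (@ar_ext _ _ (fun a => exists W, lmem a W /\
  forall i, i < W -> ldrop W i <> 0 -> exists l, J l (lnth W i) /\
    forall j, j < l -> ldrop l j <> 0 -> lmem (lnth l j) (ldrop W i.+1))); last first.
  move=> a; split=> [[W [a_W dW]]|/Der_derivation[ws /derivationE dws a_ws]].
    have [ws e] := lc_surj W; rewrite e in a_W dW.
    apply: derivation_Der; [apply/derivationE; exact: dW|exact/lmemP].
  by exists (lc ws); split=> //; apply/lmemP.
ar_tac.
pose f c := cpair (pi1 c) (lnth (pi1 (pi2 (pi2 c))) (pi1 (pi2 c))).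
have cf : cfun f by rewrite /f; comp_list_tac.
by apply: ar_ext (ar_sub cf aJ) _ => c; rewrite /f !pi_cpairE.
Qed.

(** * Evaluation of coded programs *)

(** A structural code on which rules can match by pairing alone. The passage from the official
    numbering [pickle] to this code is [stack_code]. *)
Fixpoint tc (t : GenTree.tree nat) : nat :=
  match t with
  | GenTree.Leaf i => cpair 0 i
  | GenTree.Node n ts => cpair n.+1 (lc (map tc ts))
  end.

Lemma tc_inj : injective tc.
Proof.
elim=> [i|n ts IH] [j|m us] //= /cpair_inj[] //; first by move=> _ ->.
move=> -[->] /lc_inj e; congr GenTree.Node.
elim: ts us IH e => [|t ts IHt] [|u us] //= [IH1 IH2] [/IH1-> /(IHt _ IH2)->//].
Qed.

Definition rc (p : rfun) : nat := tc (rfun_enc p).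

Lemma lhd_lc xs : lhd (lc xs) = head 0 xs.
Proof. by case: xs => [|x xs]; rewrite /= ?lhd_cons // /lhd pi10. Qed.

(** Supplies induction hypotheses for the list of programs inside [rComp]. *)
Lemma rfun_ind_nested (P : rfun -> Prop) :
  P rZero -> P rSucc -> (forall i, P (rProj i)) ->
  (forall f gs, P f -> foldr (fun g Q => P g /\ Q) True gs -> P (rComp f gs)) ->
  (forall f g, P f -> P g -> P (rPrec f g)) -> (forall f, P f -> P (rMin f)) ->
  forall p, P p.
Proof.
move=> P0 P1 P2 P3 P4 P5; fix IH 1 => -[||i|f gs|f g|f].
- exact: P0.
- exact: P1.
- exact: P2.
- apply: P3 (IH f) _; elim: gs => [|g gs IHgs]; [exact: Logic.I|split; [exact: IH|exact: IHgs]].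
- exact: P4 (IH f) (IH g).
- exact: P5 (IH f).
Qed.

Lemma eval_fun p xs y y' : eval p xs y -> eval p xs y' -> y = y'.
Proof.
elim/rfun_ind_nested: p xs y y' => [||i|f gs IHf IHgs|f g IHf IHg|f IHf] xs y y'.
- by inversion 1; inversion 1.
- by inversion 1; inversion 1.
- by inversion 1; inversion 1.
- inversion 1 as [| | |? ? ? ys ? evs evf| | |]; subst; inversion 1 as [| | |? ? ? ys' ? evs' evf'| | |]; subst.
  suff e : ys = ys' by apply: IHf evf _; rewrite e.
  elim: gs IHgs ys ys' evs evs' {evf evf' H H0} => [|g gs IH] /=.
    by move=> _ ys ys'; inversion 1; inversion 1.
  move=> [IHg /IH{}IH] ys ys'; inversion 1 as [|? ? ? z zs ez ezs]; subst.
  inversion 1 as [|? ? ? z' zs' ez' ezs']; subst.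
  by rewrite (IHg _ _ _ ez ez') (IH _ _ ezs ezs').
- case: xs => [|k xs]; first by inversion 1.
  elim: k y y' => [|k IH] y y'; inversion 1; subst; inversion 1; subst.
    by apply: IHf; eassumption.
  have e : v = v0 by apply: IH; eassumption.
  by subst v0; apply: IHg; eassumption.
- inversion 1 as [| | | | | |? ? ? f0 fmin]; subst; inversion 1 as [| | | | | |? ? ? f0' fmin']; subst.
  case: (ltngtP y y') => // [/fmin'|/fmin] [v].
    by move=> /(IHf _ _ _ f0).
  by move=> /(IHf _ _ _ f0').
Qed.

(** The tags 1 to 6 are the labels of [rfun_enc] shifted by one, because [tc] reserves 0 for leaves.
    In the clause for composition, [k] is forced to be the common length of [gs] and [ys]. *)
Definition eval_rule (l e xs y : nat) : Prop :=
  (e = cpair 1 0 /\ y = 0) \/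
  (e = cpair 2 0 /\ y = (lhd xs).+1) \/
  (exists i, e = cpair 3 (lcons (cpair 0 i) 0) /\ y = lnth xs i) \/
  (exists f gs ys k, e = cpair 4 (lcons f gs) /\ lmem (cpair f (cpair ys y)) l /\
     ldrop gs k = 0 /\ ldrop ys k = 0 /\
     forall i, i < k -> ldrop gs i <> 0 /\ ldrop ys i <> 0 /\
       lmem (cpair (lnth gs i) (cpair xs (lnth ys i))) l) \/
  (exists f g xs', e = cpair 5 (lcons f (lcons g 0)) /\ xs = lcons 0 xs' /\
     lmem (cpair f (cpair xs' y)) l) \/
  (exists f g xs' k v, e = cpair 5 (lcons f (lcons g 0)) /\ xs = lcons k.+1 xs' /\
     lmem (cpair e (cpair (lcons k xs') v)) l /\
     lmem (cpair g (cpair (lcons k (lcons v xs')) y)) l) \/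
  (exists f, e = cpair 6 (lcons f 0) /\ lmem (cpair f (cpair (lcons y xs) 0)) l /\
     forall z, z < y -> exists v, lmem (cpair f (cpair (lcons z xs) v.+1)) l).

Definition eval_code : nat -> Prop :=
  Der (fun l a => eval_rule l (pi1 a) (pi1 (pi2 a)) (pi2 (pi2 a))).

Lemma ar_eval_code : ar 1 true eval_code.
Proof. by apply: ar_Der; rewrite /eval_rule; ar_tac. Qed.

Lemma eval_code_elim p xs y : eval_code (cpair (rc p) (cpair (lc xs) y)) ->
  exists l, eval_rule l (rc p) (lc xs) y /\
    forall q zs z, lmem (cpair (rc q) (cpair (lc zs) z)) l -> eval_code (cpair (rc q) (cpair (lc zs) z)).
Proof. by case=> l Hl; rewrite !pi_cpairE => Jl; exists l; split=> // q zs z /Hl. Qed.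

Lemma eval_code_intro p xs y (G : seq (rfun * seq nat * nat)) :
  let code g := cpair (rc g.1.1) (cpair (lc g.1.2) g.2) in
  (forall g, g \in G -> eval_code (code g)) ->
  eval_rule (lc (map code G)) (rc p) (lc xs) y -> eval_code (cpair (rc p) (cpair (lc xs) y)).
Proof.
move=> code HG Jl; apply: (DerI (l := lc (map code G))); last by rewrite !pi_cpairE.
by move=> b /lmemP/mapP[g /HG Hg ->].
Qed.


Ltac code_inv := repeat match goal with
  | H : ex _ |- _ => destruct H
  | H : _ /\ _ |- _ => destruct H
  | H : cpair _ _ = cpair _ _ |- _ => apply cpair_inj in H
  | H : lcons _ _ = lcons _ _ |- _ => apply lcons_inj in H
  | H : S _ = S _ |- _ => injection H as H
  | H : 0 = lcons _ _ |- _ => discriminate H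
  | H : lcons _ _ = 0 |- _ => discriminate H
  | H : 0 = S _ |- _ => discriminate H
  | H : S _ = 0 |- _ => discriminate H
  end.

(** Induction on the program, with an inner induction on the recursion argument for [rPrec]: every
    premise concerns an immediate subprogram, or the same recursion at a smaller argument. *)
Lemma eval_code_eval p xs y : eval_code (cpair (rc p) (cpair (lc xs) y)) -> eval p xs y.
Proof.
elim/rfun_ind_nested: p xs y => [||i|f gs IHf IHgs|f g IHf IHg|f IHf] xs y.
- case/eval_code_elim=> l [Jl Hl]; move: Jl => [|[|[|[|[|[|]]]]]]; rewrite /rc /= => Jl; code_inv.
  by subst; apply: evZero.
- case/eval_code_elim=> l [Jl Hl]; move: Jl => [|[|[|[|[|[|]]]]]]; rewrite /rc /= => Jl; code_inv.
  by subst; rewrite lhd_lc; apply: evSucc.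
- case/eval_code_elim=> l [Jl Hl]; move: Jl => [|[|[|[|[|[|]]]]]]; rewrite /rc /= => Jl; code_inv.
  by subst; rewrite lnth_lc; apply: evProj.
- case/eval_code_elim=> l [Jl Hl]; move: Jl => [|[|[|[|[|[|]]]]]]; rewrite /rc /= => Jl; code_inv.
  rename x1 into cys, x2 into k.
  have [ys e] := lc_surj cys; subst.
  rewrite -/(rc f) in H0; apply: evComp (IHf ys y (Hl _ _ _ H0)).
  have k_gs : size gs <= k.
    by move: H1; rewrite -map_comp ldrop_lc => /lc_eq0/(congr1 size); rewrite size_drop size_map /=; lia.
  have k_ys : size ys <= k.
    by move: H2; rewrite ldrop_lc => /lc_eq0/(congr1 size); rewrite size_drop /=; lia.
  have {H1 H2}[e1 e2] : size gs = k /\ size ys = k.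
    split.
    + case: (ltnP (size gs) k) => [lt_k|]; last by lia.
      by have [/ldrop_neq0] := H3 _ lt_k; rewrite !size_map ltnn.
    + case: (ltnP (size ys) k) => [lt_k|]; last by lia.
      by have [_ [/ldrop_neq0]] := H3 _ lt_k; rewrite ltnn.
  have {H3}H i : i < size gs -> eval_code (cpair (rc (nth rZero gs i)) (cpair (lc xs) (nth 0 ys i))).
    move=> lt_i; have [|_ [_]] := H3 i; first by rewrite -e1.
    by rewrite -map_comp !lnth_lc (nth_map rZero) // => /Hl.
  have {e1 e2} : size gs = size ys by rewrite e1.
  elim: gs ys IHgs H {Hl H0 k_gs k_ys} => [|g gs IH] [|z zs] //= IHgs H.
    by move=> _; apply: evsNil.
  move=> [e]; have [IHg {}IHgs] := IHgs; apply: evsCons; first exact: IHg (H 0 isT).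
  by apply: (IH _ IHgs) => // i lt_i; exact: (H i.+1).
- case: xs => [|k xs].
    case/eval_code_elim=> l [Jl Hl]; move: Jl => [|[|[|[|[|[|]]]]]]; rewrite /rc /= => Jl; code_inv.
  elim: k y => [|k IH] y.
    case/eval_code_elim=> l [Jl Hl]; move: Jl => [|[|[|[|[|[|]]]]]]; rewrite /rc /= => Jl; code_inv.
    by subst; rewrite -/(rc f) in H1; apply: evPrec0; apply: IHf (Hl _ _ _ H1).
  case/eval_code_elim=> l [Jl Hl]; move: Jl => [|[|[|[|[|[|]]]]]]; rewrite /rc /= => Jl; code_inv.
  rename x3 into v; subst; rename x2 into k.
  rewrite -/(rc f) -/(rc g) in H1 H2.
  apply: (@evPrecS f g k xs v y).
    by apply: IH; apply: (Hl (rPrec f g) (k :: xs) v).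
  by apply: IHg; apply: (Hl g [:: k, v & xs]).
- case/eval_code_elim=> l [Jl Hl]; move: Jl => [|[|[|[|[|[|]]]]]]; rewrite /rc /= => Jl; code_inv.
  subst; rewrite -/(rc f) in H0 H1; apply: evMin; first by apply: IHf; apply: (Hl f (y :: xs)).
  by move=> z /H1[v Hv]; exists v; apply: IHf; apply: (Hl f (z :: xs)).
Qed.

Lemma eval_eval_code p xs y : eval p xs y -> eval_code (cpair (rc p) (cpair (lc xs) y)).
Proof.
elim/rfun_ind_nested: p xs y => [||i|f gs IHf IHgs|f g IHf IHg|f IHf] xs y.
- inversion 1; subst; apply: (eval_code_intro (G := [::])) => //; by left.
- inversion 1; subst; apply: (eval_code_intro (G := [::])) => //; right; left.
  by rewrite lhd_lc.
- inversion 1; subst; apply: (eval_code_intro (G := [::])) => //; do 2!right; left.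
  by exists i; rewrite lnth_lc.
- inversion 1 as [| | |? ? ? ys ? evs evf| | |]; subst.
  have {H evs}[esize evs] : size gs = size ys /\ forall i, i < size gs ->
      eval_code (cpair (rc (nth rZero gs i)) (cpair (lc xs) (nth 0 ys i))).
    elim: gs IHgs ys evs {evf H} => [|g gs IH] /=; first by move=> _ ys; inversion 1.
    move=> [IHg /IH{}IH] ys; inversion 1 as [|? ? ? z zs ez ezs]; subst.
    have [-> H'] := IH _ ezs; split=> // -[_|i] /=; [exact: IHg|exact: H'].
  apply: (eval_code_intro (G := (f, ys, y) :: mkseq (fun i => (nth rZero gs i, xs, nth 0 ys i)) (size gs))).
    move=> h; rewrite inE => /orP[/eqP->|/mapP[i]]; first exact: IHf.
    by rewrite mem_iota => /evs Hi ->.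
  do 3!right; left; exists (rc f), (lc (map rc gs)), (lc ys), (size gs).
  split; first by rewrite /rc /= -map_comp.
  split; first by apply/lmemP; rewrite inE eqxx.
  split; first by rewrite ldrop_lc drop_oversize ?size_map.
  split; first by rewrite ldrop_lc drop_oversize ?esize.
  move=> i lt_i; split; first by apply/ldrop_neq0; rewrite size_map.
  split; first by apply/ldrop_neq0; rewrite -esize.
  apply/lmemP; rewrite inE; apply/orP; right; apply/mapP; rewrite !lnth_lc.
  exists (nth rZero gs i, xs, nth 0 ys i); last by rewrite (nth_map rZero).
  by apply/mapP; exists i; rewrite ?mem_iota.
- case: xs => [|k xs]; first by inversion 1.
  elim: k y => [|k IH] y; inversion 1; subst.
    apply: (eval_code_intro (G := [:: (f, xs, y)])) => [h|]; first by rewrite inE => /eqP->; apply: IHf.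
    do 4!right; left; exists (rc f), (rc g), (lc xs); split=> //; split=> //.
    by apply/lmemP; rewrite inE eqxx.
  apply: (eval_code_intro (G := [:: (rPrec f g, k :: xs, v); (g, [:: k, v & xs], y)])) => [h|].
    by rewrite !inE => /orP[] /eqP->; [apply: IH|apply: IHg].
  do 5!right; left; exists (rc f), (rc g), (lc xs), k, v; split=> //; split=> //.
  by split; apply/lmemP; rewrite !inE eqxx ?orbT.
- inversion 1 as [| | | | | |? ? ? f0 fmin]; subst.
  have /functional_choice[v Hv] : forall z, exists v, z < y -> eval f (z :: xs) v.+1.
    move=> z; case: (ltnP z y) => [/fmin[v Hv]|_]; [by exists v|by exists 0].
  apply: (eval_code_intro (G := (f, y :: xs, 0) :: mkseq (fun z => (f, z :: xs, (v z).+1)) y)).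
    move=> h; rewrite inE => /orP[/eqP->|/mapP[z]]; first exact: IHf.
    by rewrite mem_iota => /Hv Hz ->; apply: IHf.
  do 6!right; exists (rc f); split=> //; split; first by apply/lmemP; rewrite inE eqxx.
  move=> z lt_z; exists (v z); apply/lmemP; rewrite inE; apply/orP; right.
  apply/mapP; exists (f, z :: xs, (v z).+1) => //.
  by apply/mapP; exists z; rewrite ?mem_iota.
Qed.

(** * The Goedel numbering is Sigma_1 *)

(** Turns the anonymous local fixpoint of [rfun_dec] into a [foldr], on which an induction can be
    run. *)
Lemma rfun_dec_comp tf tgs : rfun_dec (GenTree.Node 3 (tf :: tgs)) =
  match rfun_dec tf, foldr (fun t o => match rfun_dec t, o with
      | Some p, Some ps => Some (p :: ps) | _, _ => None end) (Some [::]) tgs with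
  | Some f, Some gs => Some (rComp f gs)
  | _, _ => None
  end.
Proof. by []. Qed.

Lemma rfun_decP t p : rfun_dec t = Some p <-> t = rfun_enc p.
Proof.
split=> [|->]; last exact: rfun_encK.
elim: t p => [//|n ts IH] p.
case: n ts IH => [|[|[|[|[|[|n]]]]]] ts IH; last by [].
- by case: ts IH => //= _ [<-].
- by case: ts IH => //= _ [<-].
- by case: ts IH => [|[i|? ?] [|? ?]] //= _ [<-].
- case: ts IH => [//|tf tgs] [IHf IHgs]; rewrite rfun_dec_comp.
  case ef: (rfun_dec tf) => [f|//].
  case egs: (foldr _ _ tgs) => [gs|//] [<-] /=.
  rewrite -(IHf _ ef); congr (GenTree.Node _ (_ :: _)); clear IHf ef.
  elim: tgs gs IHgs egs => [|t ts IH] gs /=; first by move=> _ [<-].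
  move=> [IHt /IH{}IH]; case et: (rfun_dec t) => [q|//].
  by case ets: (foldr _ _ ts) => [qs|//] [<-] /=; rewrite -(IHt _ et) -(IH _ ets).
- case: ts IH => [|tf [|tg [|? ?]]] //= [IHf [IHg _]].
  by case ef: (rfun_dec tf) => [f|//]; case eg: (rfun_dec tg) => [g|//] [<-] /=; rewrite -(IHf _ ef) -(IHg _ eg).
- case: ts IH => [|tf [|? ?]] //= [IHf _].
  by case ef: (rfun_dec tf) => [f|//] [<-] /=; rewrite -(IHf _ ef).
Qed.

(** Wanted besides [eval_code], which can hold of a code that is no program: a recursion evaluated
    at 0 never inspects its step. *)
Definition rc_rule (l e : nat) : Prop :=
  e = cpair 1 0 \/ e = cpair 2 0 \/ (exists i, e = cpair 3 (lcons (cpair 0 i) 0)) \/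
  (exists f gs, e = cpair 4 (lcons f gs) /\ lmem f l /\
     forall i, i < gs -> ldrop gs i <> 0 -> lmem (lnth gs i) l) \/
  (exists f g, e = cpair 5 (lcons f (lcons g 0)) /\ lmem f l /\ lmem g l) \/
  (exists f, e = cpair 6 (lcons f 0) /\ lmem f l).

Definition is_rc : nat -> Prop := Der rc_rule.

Lemma ar_is_rc : ar 1 true is_rc.
Proof. by apply: ar_Der; rewrite /rc_rule; ar_tac. Qed.

Lemma is_rcP e : is_rc e <-> exists p, e = rc p.
Proof.
split.
  elim=> {}e l _ IH [|[|[|[|[|]]]]] H; code_inv.
  - by exists rZero.
  - by exists rSucc.
  - by exists (rProj x).
  - rename x into f, x0 into gs; have [p ep] := IH _ H0.
    have [xs egs] := lc_surj gs; rewrite {}egs in H H1.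
    suff [qs eqs] : exists qs, xs = map rc qs by exists (rComp p qs); rewrite H eqs ep /rc /= -map_comp.
    have {}H1 : forall x, x \in xs -> exists q, x = rc q.
      move=> x x_xs; apply: IH; have := H1 (index x xs).
      rewrite ldrop_neq0 lnth_lc index_mem nth_index //; apply=> //.
      by apply: leq_trans (leq_size_lc xs); rewrite index_mem.
    elim: xs H1 {H} => [|x xs IHxs] H; first by exists [::].
    have [|q ->] := H x; first by rewrite inE eqxx.
    have [|qs ->] := IHxs; first by move=> z z_xs; apply: H; rewrite inE z_xs orbT.
    by exists (q :: qs).
  - by have [p ep] := IH _ H0; have [q eq] := IH _ H1; exists (rPrec p q); rewrite H ep eq.
  - by have [p ep] := IH _ H0; exists (rMin p); rewrite H ep.
case=> p ->; elim/rfun_ind_nested: p => [||i|f gs IHf IHgs|f g IHf IHg|f IHf].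
- by apply: (DerI (l := lc [::])) => [b /(lmemP b [::])//|]; left.
- by apply: (DerI (l := lc [::])) => [b /(lmemP b [::])//|]; right; left.
- by apply: (DerI (l := lc [::])) => [b /(lmemP b [::])//|]; do 2!right; left; exists i.
- apply: (DerI (l := lc (rc f :: map rc gs))).
    move=> b /(lmemP b (rc f :: map rc gs)); rewrite inE => /orP[/eqP->//|].
    by elim: gs IHgs => //= g gs IH [Hg Hgs]; rewrite inE => /orP[/eqP->//|/(IH Hgs)].
  do 3!right; left; exists (rc f), (lc (map rc gs)); split; first by rewrite /rc /= -map_comp.
  split; first by apply/lmemP; rewrite inE eqxx.
  move=> i _; rewrite ldrop_neq0 lnth_lc => lt_i.
  by apply/(lmemP _ (rc f :: map rc gs)); rewrite inE mem_nth ?orbT.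
- apply: (DerI (l := lc [:: rc f; rc g])) => [b /(lmemP b [:: _; _])|]; first by rewrite !inE => /orP[] /eqP->.
  do 4!right; left; exists (rc f), (rc g).
  by split=> //; split; apply/(lmemP _ [:: rc f; rc g]); rewrite !inE eqxx ?orbT.
- apply: (DerI (l := lc [:: rc f])) => [b /(lmemP b [:: _])|]; first by rewrite !inE => /eqP->.
  by do 5!right; exists (rc f); split=> //; apply/(lmemP _ [:: rc f]); rewrite inE eqxx.
Qed.

(** [unpickle] at the type [nat + nat], made explicit: the sum is represented as a pair of options,
    and an option as the head of a coded list. *)
Definition utok (v : nat) : option (nat + nat) :=
  if CodeSeq.decode v is [:: ni; nx] then
    sum_of_opair (ohead (CodeSeq.decode ni), ohead (CodeSeq.decode nx))
  else None.

Definition token_stack (a : nat) : seq (GenTree.tree nat) * seq (seq (GenTree.tree nat)) :=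
  foldr (@GenTree.decode_step nat) ([::], [::]) (pmap utok (CodeSeq.decode a)).

Lemma progE a : prog a = obind rfun_dec (ohead (token_stack a).1).
Proof.
have e : (unpickle : nat -> option (nat + nat)) =1 utok.
  move=> v; rewrite /utok.
  transitivity (obind sum_of_opair (omap pair_of_tag
    (@unpickle_tagged (option nat) (fun=> option nat) v))); first by [].
  rewrite /unpickle_tagged; case: (CodeSeq.decode v) => [|ni [|nx []]] //.
  have e n : (unpickle n : option (option nat)) = Some (ohead (CodeSeq.decode n)).
    transitivity (Some (ohead (pmap Some (CodeSeq.decode n)))) => //; congr (Some (ohead _)).
    by elim: (CodeSeq.decode n) => //= x s ->.
  transitivity (obind sum_of_opair (omap pair_of_tag
    (obind (fun i => omap (@Tagged (option nat) i (fun=> option nat)) (unpickle nx : option (option nat)))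
       (unpickle ni : option (option nat))))); first by [].
  by rewrite !e.
transitivity (obind rfun_dec (GenTree.decode
  (pmap (unpickle : nat -> option (nat + nat)) (CodeSeq.decode a)))); first by [].
by rewrite (eq_pmap e).
Qed.

Definition csc (v m : nat) : nat := 2 ^ v * (m + m).+1.

Lemma cscE v s : csc v (CodeSeq.code s) = CodeSeq.code (v :: s).
Proof. by rewrite /csc addnn. Qed.

Lemma code_surj a : exists s, a = CodeSeq.code s.
Proof. by exists (CodeSeq.decode a); rewrite CodeSeq.decodeK. Qed.

Lemma csc_inj v m v' m' : csc v m = csc v' m' -> v = v' /\ m = m'.
Proof.
have [s ->] := code_surj m; have [s' ->] := code_surj m'; rewrite !cscE.
by move/(can_inj CodeSeq.codeK) => [-> ->].
Qed.

Lemma csc_neq0 v m : csc v m <> 0.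
Proof. by apply/eqP; rewrite /csc muln_eq0 expn_eq0. Qed.

Definition chead (n v : nat) : Prop := exists m, n = csc v m.

Lemma cheadP n v : chead n v <-> ohead (CodeSeq.decode n) = Some v.
Proof.
have [s ->] := code_surj n; rewrite CodeSeq.codeK; split=> [[m]|].
  have [s' ->] := code_surj m; rewrite cscE => /(can_inj CodeSeq.codeK) -> //.
by case: s => [|u s] // [<-]; exists (CodeSeq.code s); rewrite cscE.
Qed.

Definition tok_inr (a y : nat) : Prop := exists ni nx, a = csc ni (csc nx 0) /\ chead nx y.
Definition tok_inl (a x : nat) : Prop := exists ni, a = csc ni (csc 0 0) /\ chead ni x.
(** Failure of [utok] stated positively, by lists of length 0, 1 or at least 3, or two empty
    options: the rules must be Sigma_1, and the negation of the existential [tok_inl] and [tok_inr]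
    would come out as Pi_1. *)
Definition tok_none (a : nat) : Prop :=
  a = 0 \/ (exists v, a = csc v 0) \/ (exists v w u m, a = csc v (csc w (csc u m))) \/
  a = csc 0 (csc 0 0).

Lemma csc2E ni nx : csc ni (csc nx 0) = CodeSeq.code [:: ni; nx].
Proof. by rewrite -!cscE. Qed.

Lemma utokP a : match utok a with
  | Some (inr y) => tok_inr a y
  | Some (inl x) => tok_inl a x
  | None => tok_none a end.
Proof.
have [s ->] := code_surj a; rewrite /utok CodeSeq.codeK.
case: s => [|ni [|nx [|u s]]].
- by left.
- by right; left; exists ni; rewrite -(cscE ni [::]).
- rewrite /sum_of_opair /=; case ex: (ohead (CodeSeq.decode nx)) => [y|] /=.
    by exists ni, nx; rewrite csc2E; split=> //; apply/cheadP.
  have -> : nx = 0.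
    by move: ex; have [[|z t] ->] := code_surj nx; rewrite CodeSeq.codeK.
  case ei: (ohead (CodeSeq.decode ni)) => [x|] /=.
    by exists ni; rewrite csc2E; split=> //; apply/cheadP.
  have -> : ni = 0.
    by move: ei; have [[|z t] ->] := code_surj ni; rewrite CodeSeq.codeK.
  by do 3!right; rewrite csc2E.
- by do 2!right; left; exists ni, nx, u, (CodeSeq.code s); rewrite -!cscE.
Qed.

Lemma tok_inr_utok a y : tok_inr a y -> utok a = Some (inr y).
Proof.
move=> [ni [nx [-> /cheadP e]]]; rewrite csc2E /utok CodeSeq.codeK /sum_of_opair.
by rewrite [(_, _).2]/= e.
Qed.

Lemma tok_inl_utok a x : tok_inl a x -> utok a = Some (inl x).
Proof.
move=> [ni [-> /cheadP e]]; rewrite csc2E /utok CodeSeq.codeK /sum_of_opair.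
by rewrite [(_, _).2]/= [(_, _).1]/= e.
Qed.

Lemma tok_none_utok a : tok_none a -> utok a = None.
Proof.
rewrite /utok => -[->//|[[v]|[[v [w [u [m]]]]|]]].
- by rewrite (cscE v [::]) => ->; rewrite CodeSeq.codeK.
- by have [s ->] := code_surj m; rewrite !cscE => ->; rewrite CodeSeq.codeK.
- by rewrite csc2E => ->; rewrite CodeSeq.codeK.
Qed.

(** One step of the parser [GenTree.decode_step]: [s1] holds the siblings read so far, [s2] the
    suspended lists. Words that are not tokens are skipped, as [pmap] does, and [lhd 0 = ltl 0 = 0]
    matches the behaviour on an empty stack. *)
Definition stack_rule (l a s1 s2 : nat) : Prop :=
  (a = 0 /\ s1 = 0 /\ s2 = 0) \/
  (exists v m t1 t2, a = csc v m /\ lmem (cpair m (cpair t1 t2)) l /\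
    ((tok_none v /\ s1 = t1 /\ s2 = t2) \/
     (exists x, tok_inr v x /\ s1 = lcons (cpair 0 x) t1 /\ s2 = t2) \/
     (tok_inl v 0 /\ s1 = 0 /\ s2 = lcons t1 t2) \/
     (exists n, tok_inl v n.+1 /\ s1 = lcons (cpair n.+1 t1) (lhd t2) /\ s2 = ltl t2))).

Definition stack_code : nat -> Prop :=
  Der (fun l a => stack_rule l (pi1 a) (pi1 (pi2 a)) (pi2 (pi2 a))).

Lemma ar_stack_code : ar 1 true stack_code.
Proof.
apply: ar_Der; rewrite /stack_rule /tok_none /tok_inr /tok_inl /chead /csc; ar_tac.
Qed.

Definition sc (fs : seq (GenTree.tree nat) * seq (seq (GenTree.tree nat))) : nat :=
  cpair (lc (map tc fs.1)) (lc (map (fun ts => lc (map tc ts)) fs.2)).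

Lemma stack_codeP a c : stack_code (cpair a c) <-> c = sc (token_stack a).
Proof.
have [s ->] := code_surj a; rewrite /token_stack CodeSeq.codeK.
set F := foldr _ _.
have FE v t : F (pmap utok (v :: t)) =
    (if utok v is Some u then GenTree.decode_step u (F (pmap utok t)) else F (pmap utok t)).
  by rewrite /=; case: (utok v).
elim: s c => [|v s IH] c; split.
- case=> l _; rewrite !pi_cpairE => -[[_ [e1 e2]]|[v [m [? [? [/esym/csc_neq0//]]]]]].
  by rewrite -(cpair_pi c) e1 e2.
- by move=> ->; apply: (DerI (l := 0)) => [b /(lmemP b [::])//|]; left; rewrite !pi_cpairE.
- case=> l Hl; rewrite !pi_cpairE -cscE => -[[/csc_neq0//]|[v' [m [t1 [t2 [/csc_inj[<- <-] [/Hl/IH]]]]]]].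
  move/esym/cpair_inj=> [<- <-] H; rewrite -[c]cpair_pi; move: H.
  rewrite FE; case: (F _) => fs1 fs2 /= H.
  case: H => [[/tok_none_utok-> [-> ->]]|[[x [/tok_inr_utok-> [-> ->]]]|[[/tok_inl_utok-> [-> ->]]|]]] //.
  move=> [n [/tok_inl_utok-> [-> ->]]] /=; case: fs2 => [|f fs2] /=; last by rewrite lhd_cons ltl_cons.
  by rewrite /lhd /ltl pi10 pi20.
- move=> ->; apply: (DerI (l := lc [:: cpair (CodeSeq.code s)
     (sc (F (pmap utok s)))])).
    by move=> b /(lmemP b [:: _]); rewrite inE => /eqP->; apply/IH.
  rewrite !pi_cpairE -cscE; right; exists v, (CodeSeq.code s).
  set fs := F (pmap utok s).
  exists (lc (map tc fs.1)), (lc (map (fun ts => lc (map tc ts)) fs.2)); split=> //.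
  split; first by apply/(lmemP _ [:: _]); rewrite inE.
  rewrite FE; have := utokP v; case: (utok v) => [[[|n]|x]|] Hv.
  + by do 2!right; left; rewrite -/fs /=.
  + do 3!right; exists n; rewrite -/fs /=; split=> //.
    case: (fs.2) => [|f fs2] /=; last by rewrite lhd_cons ltl_cons.
    by rewrite /lhd /ltl pi10 pi20.
  + by right; left; exists x; rewrite -/fs /=.
  + by left; rewrite -/fs /=.
Qed.

(** [GenTree.decode] returns the first tree left by the parser, so [s1] and [s2] are arbitrary
    remainders. *)
Definition prog_eval (a xs y : nat) : Prop :=
  exists e s1 s2, stack_code (cpair a (cpair (lcons e s1) s2)) /\ is_rc e /\
    eval_code (cpair e (cpair xs y)).

Lemma prog_evalP a xs y :
  prog_eval a (lc xs) y <-> exists2 p, prog a = Some p & eval p xs y.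
Proof.
split=> [[e [s1 [s2 [/stack_codeP H [/is_rcP[p ep] ev]]]]]|[p pa ev]].
  rewrite {}ep in H ev; move/eval_code_eval: ev => ev.
  move: H; rewrite /sc => /cpair_inj[+ _].
  case ts: (token_stack a).1 => [|t ts'] //= /lcons_inj[et _].
  exists p => //; rewrite progE ts /=; apply/rfun_decP; apply: tc_inj; exact: esym et.
move: pa; rewrite progE; case ts: (token_stack a).1 => [|t ts'] //= /rfun_decP et.
exists (rc p), (lc (map tc ts')), (lc (map (fun ts => lc (map tc ts)) (token_stack a).2)).
split; first by apply/stack_codeP; rewrite /sc ts /= et.
by split; [apply/is_rcP; exists p|apply: eval_eval_code].
Qed.

Lemma ar_prog_eval m s f g h : 0 < m -> cfun f -> cfun g -> cfun h ->
  (m = 1 -> s = true) -> ar m s (fun x => prog_eval (f x) (g x) (h x)).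
Proof.
have a1 := ar_stack_code; have a2 := ar_is_rc; have a3 := ar_eval_code.
move=> m_gt0 cf cg ch ms.
have a : ar 1 true (fun x => prog_eval (f x) (g x) (h x)) by rewrite /prog_eval; ar_tac.
case: (ltnP 1 m) => [lt_m|le_m]; first exact: ar_lift lt_m a.
by have e : m = 1 by [lia|]; rewrite e ms.
Qed.

(** * Coded arguments versus argument lists *)

(** Each quantifier of [arith] prepends a variable where [ar] pairs one in front; [k] counts the
    quantifiers passed. The default of [nth] makes the translation total on lists of any length. *)
Fixpoint encode_args (k j : nat) (xs : seq nat) : nat :=
  if k is k'.+1 then cpair (nth 0 xs j) (encode_args k' j.+1 xs) else nth 0 xs j.

Lemma encode_args_cons k j y xs : encode_args k j.+1 (y :: xs) = encode_args k j xs.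
Proof. by elim: k j => //= k IH j; rewrite IH. Qed.

Lemma eval_encode_args k j : exists p, forall xs, eval p xs (encode_args k j xs).
Proof.
elim: k j => [|k IH] j; first by exists (rProj j) => xs; apply: evProj.
have [p Hp] := IH j.+1; have [q Hq] := comp2_cpair.
exists (rComp q [:: rProj j; p]) => xs.
by apply: eval_comp2 (Hq _ _); [apply: evProj|apply: Hp].
Qed.

Lemma ar_arith m s P k : ar m s P -> arith m s (fun xs => P (encode_args k 0 xs)).
Proof.
elim: m s P k => [|m IH] s P k.
  move=> [f [cf Hf]]; have [q Hq] := eval_encode_args k 0.
  have [p Hp] : cfun (fun x => 1 - f x) by comp_tac.
  exists (rComp p [:: q]) => xs; set x := encode_args k 0 xs.
  have ev : eval (rComp p [:: q]) xs (1 - f x) by apply: eval_comp1 (Hq xs) (Hp x).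
  case e: (f x) ev => [|v] ev; [left|right]; split=> //; first exact/Hf.
  by move/Hf; rewrite e.
move=> [Q [/(IH _ _ k.+1) aQ HQ]]; exists (fun xs => Q (encode_args k.+1 0 xs)); split=> // xs.
rewrite HQ /=; case: s {aQ HQ}.
  by split=> -[y Hy]; exists y; move: Hy; rewrite encode_args_cons.
by split=> H y; have := H y; rewrite encode_args_cons.
Qed.

Fixpoint decode_args (k c : nat) : seq nat :=
  if k is k'.+1 then pi1 c :: decode_args k' (pi2 c) else [:: c].

Lemma evals_decode_args k f : cfun f ->
  exists qs, forall c, evals qs [:: c] (decode_args k (f c)).
Proof.
elim: k f => [|k IH] f cf.
  by have [p Hp] := cf; exists [:: p] => c; apply: evsCons (Hp c) (evsNil _).
have [qs Hqs] := IH _ (comp_pi2 cf); have [p Hp] := comp_pi1 cf.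
by exists (p :: qs) => c; apply: evsCons (Hp c) (Hqs c).
Qed.

Lemma arith_ar m s R k : arith m s R -> ar m s (fun c => R (decode_args k c)).
Proof.
elim: m s R k => [|m IH] s R k.
  move=> [p Hp]; have [qs Hqs] := evals_decode_args k comp_id.
  have /functional_choice[v Hv] : forall c, exists v,
      eval (rComp p qs) [:: c] v /\ (R (decode_args k c) <-> v = 1).
    move=> c; have [[Rc ev]|[nRc ev]] := Hp (decode_args k c).
      by exists 1; split=> //; apply: evComp (Hqs c) ev.
    by exists 0; split; [apply: evComp (Hqs c) ev|split].
  have cv : cfun v by exists (rComp p qs) => c; have [] := Hv c.
  by apply: recp_ext (recp_eq cv (comp_const 1)) _ => c; have [_ ->] := Hv c.
move=> [S [/(IH _ _ k.+1) aS HS]]; exists (fun c => S (decode_args k.+1 c)); split=> // x.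
rewrite HS /=; case: s {aS HS}.
  by split=> -[y Hy]; exists y; move: Hy; rewrite !pi_cpairE.
by split=> H y; have := H y; rewrite !pi_cpairE.
Qed.

Lemma Pi0_setP m A : Pi0_set m A <-> ar m false A.
Proof.
split=> [[R [/(@arith_ar _ _ _ 0) aR HR]]|aA]; first by apply: ar_ext aR _ => x; rewrite HR.
by exists (fun xs => A (encode_args 0 0 xs)); split; first exact: (@ar_arith _ _ _ 0).
Qed.

(** * Specialisation of programs *)

Definition const_prog (x : nat) : rfun := iter x (fun q => rComp rSucc [:: q]) rZero.

Definition spec_prog (p : rfun) (x : nat) : rfun := rComp p [:: const_prog x; rProj 0].

Lemma eval_spec_prog p x y v : eval p [:: x; y] v -> eval (spec_prog p x) [:: y] v.
Proof.
apply: eval_comp2; last exact: eval_proj.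
by elim: x => [|x IH]; [apply: evZero|apply: eval_succ IH _].
Qed.

Lemma comp_foldr_csc s f : cfun f -> cfun (fun x => foldr csc (f x) s).
Proof. by move=> cf; elim: s => //= v s IH; rewrite /csc; comp_tac. Qed.

(* [T] stands for [pickle], whose values on tokens are too large to be computed with. *)
Lemma comp_code_spec_prog (T : nat + nat -> nat) p :
  cfun (fun x => foldr csc 0 (map T (GenTree.encode (rfun_enc (spec_prog p x))))).
Proof.
pose tokens q := map T (GenTree.encode (rfun_enc q)).
pose A := [:: T (inl 4), T (inl 2) & [:: T (inl 0)]].
(* The token word of [const_prog x] is the block [A] repeated [x] times, the word of [rZero], then
   [x] closing tokens. Both repetitions are iterations of a fixed computable function on codes. *)
have tokens_const x m : foldr csc m (tokens (const_prog x)) =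
    iter x (fun m => foldr csc m A) (foldr csc (iter x (csc (T (inl 0))) m) (tokens rZero)).
  elim: x m => [//|x IH] m; rewrite iterS [iter x.+1 (csc _) m]iterSr -IH.
  have -> : tokens (const_prog x.+1) = A ++ tokens (const_prog x) ++ [:: T (inl 0)].
    by rewrite /tokens /= cats0 map_rcons -cats1.
  by rewrite !foldr_cat.
pose m0 := foldr csc 0 (tokens (rProj 0) ++ [:: T (inl 0)]).
pose e x := foldr csc (foldr csc m0 (tokens (const_prog x))) (T (inl 4) :: tokens p).
apply: (@comp_ext e).
  apply: comp_foldr_csc.
  apply: (@comp_ext (fun x => iter x (fun m => foldr csc m A)
    (foldr csc (iter x (csc (T (inl 0))) m0) (tokens rZero)))); last first.
    by move=> x; rewrite tokens_const.
  apply: comp_iter; [exact: comp_foldr_csc comp_id|exact: comp_id|].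
  apply: comp_foldr_csc; apply: comp_iter; [|exact: comp_id|exact: comp_const].
  by apply: (comp_foldr_csc [:: T (inl 0)] comp_id).
move=> x; rewrite /e /m0 -!foldr_cat /tokens.
by rewrite /= map_rcons !map_cat -cats1 -!catA.
Qed.

Lemma pickle_rfunE (p : rfun) :
  pickle p = foldr csc 0 (map pickle (GenTree.encode (rfun_enc p))).
Proof.
transitivity (CodeSeq.code (map pickle (GenTree.encode (rfun_enc p)))); first by [].
by elim: (map _ _) => //= v s ->; rewrite /csc addnn.
Qed.

Lemma spec_prog_computable p : exists f, cfun f /\ forall x, prog (f x) = Some (spec_prog p x).
Proof.
exists (fun x => pickle (spec_prog p x)); split; last by move=> x; apply: pickleK.
apply: comp_ext (comp_code_spec_prog pickle p) _ => x; exact/esym/pickle_rfunE.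
Qed.

(** * Matching two colourings *)

(** At least [k] elements. For subsets of the natural numbers these statements, for all finite [k],
    determine the cardinality. *)
Definition has_many (k : nat) (A : nat -> Prop) : Prop :=
  exists w : nat -> nat, forall i, i < k -> A (w i) /\ forall j, j < i -> w j <> w i.

Lemma has_many_leq k k' A : k <= k' -> has_many k' A -> has_many k A.
Proof. by move=> le_k [w Hw]; exists w => i lt_i; apply: Hw; apply: leq_trans le_k. Qed.

Lemma has_many_map k A B f : (forall u, A u -> B (f u)) ->
  (forall u v, A u -> A v -> f u = f v -> u = v) -> has_many k A -> has_many k B.
Proof.
move=> AB finj [w Hw]; exists (f \o w) => i lt_i /=; have [Ai ne] := Hw i lt_i.
split=> [|j lt_j]; first exact: AB.
have [Aj _] := Hw j (ltn_trans lt_j lt_i).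
by move/(finj _ _ Aj Ai); apply: ne.
Qed.

Lemma has_many_sub k A B : (forall u, A u -> B u) -> has_many k A -> has_many k B.
Proof. by move=> AB; apply: (has_many_map (f := id)). Qed.

Lemma has_manyS k A B b : (forall u, A u -> B u) -> B b -> ~ A b -> has_many k A -> has_many k.+1 B.
Proof.
move=> AB Bb nAb [w Hw]; exists (fun i => if i < k then w i else b) => i.
rewrite ltnS leq_eqVlt => /orP[/eqP->|lt_i].
  rewrite ltnn; split=> // j lt_j; rewrite lt_j => e; apply: nAb; rewrite -e.
  by have [] := Hw j lt_j.
rewrite lt_i; have [Ai ne] := Hw i lt_i; split=> [|j lt_j]; first exact: AB.
by rewrite (ltn_trans lt_j lt_i); apply: ne.
Qed.

Lemma bool_decision (A : nat -> Prop) : exists b : nat -> bool, forall i, b i <-> A i.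
Proof.
apply: (functional_choice (fun i (v : bool) => v <-> A i)) => i.
by have [Ai|nAi] := classic (A i); [exists true|exists false].
Qed.

Definition rank (b : nat -> bool) (n : nat) : nat := count b (iota 0 n).

Lemma rankS b n : rank b n.+1 = rank b n + b n.
Proof. by rewrite /rank -addn1 iotaD count_cat /= addn0. Qed.

Lemma leq_rank b m n : m <= n -> rank b m <= rank b n.
Proof. by move/subnKC <-; rewrite /rank iotaD count_cat leq_addr. Qed.

Lemma rank_inj (b : nat -> bool) m n : b m -> b n -> rank b m = rank b n -> m = n.
Proof.
move=> bm bn e; case: (ltngtP m n) => // /(leq_rank b); rewrite rankS ?bm ?bn; lia.
Qed.

Lemma rank_onto (b : nat -> bool) r n : r < rank b n -> exists2 i, b i & rank b i = r.
Proof.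
elim: n => // n IH; rewrite rankS; case: (ltnP r (rank b n)) => [/IH//|le_r].
case bn: (b n) => /=; last by lia.
by move=> lt_r; exists n => //; lia.
Qed.

Lemma has_many_rank k (b : nat -> bool) : has_many k b <-> exists n, k <= rank b n.
Proof.
split=> [[w Hw]|[n le_k]].
  exists (\max_(i < k) w i).+1; rewrite -{1}(size_iota 0 k) -(size_map w) /rank -size_filter.
  apply: uniq_leq_size.
    rewrite map_inj_in_uniq ?iota_uniq // => i j; rewrite !mem_iota /= => lt_i lt_j e.
    case: (ltngtP i j) => // lt_ij.
      by case: (Hw j lt_j) => _ /(_ _ lt_ij)/(_ e).
    by case: (Hw i lt_i) => _ /(_ _ lt_ij)/(_ (esym e)).
  move=> u /mapP[i]; rewrite mem_iota => lt_i ->.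
  have [bi _] := Hw i lt_i; rewrite mem_filter bi mem_iota add0n ltnS.
  exact: (leq_bigmax (Ordinal lt_i)).
exists (nth 0 (filter b (iota 0 n))) => i lt_i.
have lt_i' : i < size (filter b (iota 0 n)) by rewrite size_filter (leq_trans lt_i).
split=> [|j lt_j]; first by have := mem_nth 0 lt_i'; rewrite mem_filter => /andP[].
move/eqP; rewrite nth_uniq ?filter_uniq ?iota_uniq //; first by lia.
exact: ltn_trans lt_i'.
Qed.

(** Within each colour, the element of [A] of a given rank is sent to the element of [B] of the same
    rank; the hypothesis says that the same ranks occur on both sides. *)
Lemma colour_matching (A B : nat -> Prop) (c d : nat -> nat) :
  (forall z k, has_many k (fun u => A u /\ c u = z) <-> has_many k (fun v => B v /\ d v = z)) ->
  exists f, [/\ (forall u, A u -> B (f u) /\ d (f u) = c u),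
    (forall u u', A u -> A u' -> f u = f u' -> u = u') &
    (forall v, B v -> exists2 u, A u & f u = v)].
Proof.
move=> H; have [a Ha] := bool_decision A; have [b Hb] := bool_decision B.
pose ra z := rank (fun u => a u && (c u == z)); pose rb z := rank (fun v => b v && (d v == z)).
have {H}H z k : (exists n, k <= ra z n) <-> (exists n, k <= rb z n).
  rewrite -!has_many_rank; split=> h.
    apply: (@has_many_sub k (fun v => B v /\ d v = z)); first by move=> v [/Hb-> ->] /=.
    apply/H; apply: has_many_sub h => u /andP[au /eqP e].
    by split=> //; apply/Ha.
  apply: (@has_many_sub k (fun u => A u /\ c u = z)); first by move=> v [/Ha-> ->] /=.
  apply/H; apply: has_many_sub h => u /andP[au /eqP e].
  by split=> //; apply/Hb.
have AB u : A u -> exists v, B v /\ d v = c u /\ ra (c u) u = rb (c u) v.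
  move=> /Ha au; have [|n /rank_onto[v /andP[bv /eqP e] r]] := (H (c u) (ra (c u) u).+1).1.
    by exists u.+1; rewrite /ra rankS au eqxx; lia.
  by exists v; split; [apply/Hb|].
have BA v : B v -> exists2 u, A u & d v = c u /\ ra (c u) u = rb (c u) v.
  move=> /Hb bv; have [|n /rank_onto[u /andP[au /eqP e] r]] := (H (d v) (rb (d v) v).+1).2.
    by exists v.+1; rewrite /rb rankS bv eqxx; lia.
  by exists u; [apply/Ha|rewrite e].
have /functional_choice[f Hf] : forall u, exists v, A u -> B v /\ d v = c u /\ ra (c u) u = rb (c u) v.
  by move=> u; have [/AB[v Hv]|nA] := classic (A u); [exists v|exists 0].
have finj u u' : A u -> A u' -> f u = f u' -> u = u'.
  move=> Au Au' e; have [_ [e1 e2]] := Hf u Au; have [_ [e3 e4]] := Hf u' Au'.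
  have ec : c u = c u' by rewrite -e1 -e3 e.
  apply: (@rank_inj (fun u => a u && (c u == c u'))).
  - by rewrite (Ha u).2 //= ec.
  - by rewrite (Ha u').2 //=.
  - by rewrite -ec -/(ra (c u) u) e2 e ec -e4.
exists f; split=> // [u /Hf[? []]//|v Bv].
have [u Au [e1 e2]] := BA v Bv; exists u => //; have [Bf [e3 e4]] := Hf u Au.
apply: (@rank_inj (fun v => b v && (d v == c u))).
- by rewrite (Hb _).2 //= e3.
- by rewrite (Hb _).2 //= e1.
- by rewrite -/(rb (c u) (f u)) -/(rb (c u) v) -e4.
Qed.

Lemma least_ex (P : nat -> Prop) : (exists n, P n) -> exists n, P n /\ forall m, P m -> n <= m.
Proof.
have [b Hb] := bool_decision P; case=> n /Hb bn.
have ex_b : exists n, b n by exists n.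
case: (ex_minnP ex_b) => m bm min_m; exists m; split; first exact/Hb.
by move=> k /Hb; apply: min_m.
Qed.

Lemma class_representatives (E : nat -> nat -> Prop) :
  (forall u, E u u) -> (forall u v, E u v -> E v u) -> (forall u v w, E u v -> E v w -> E u w) ->
  exists rep : nat -> nat, forall u, E u (rep u) /\ forall v, E u v <-> rep u = rep v.
Proof.
move=> Er Es Et.
have /functional_choice[rep Hrep] : forall u, exists r, E u r /\ forall r', E u r' -> r <= r'.
  by move=> u; apply: least_ex; exists u.
exists rep => u; have [Eu min_u] := Hrep u; split=> // v; have [Ev min_v] := Hrep v.
split=> [Euv|e]; last by apply: Et Eu _; apply: Es; rewrite e.
apply/eqP; rewrite eqn_leq min_u ?min_v //; last exact: Et Euv Ev.
by apply: Et Eu; apply: Es.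
Qed.

Lemma class_matching (A B : nat -> Prop) (E : nat -> nat -> Prop) :
  (forall u, E u u) -> (forall u v, E u v -> E v u) -> (forall u v w, E u v -> E v w -> E u w) ->
  (forall z k, has_many k (fun u => A u /\ E u z) <-> has_many k (fun v => B v /\ E v z)) ->
  exists f, [/\ (forall u, A u -> B (f u) /\ E u (f u)),
    (forall u u', A u -> A u' -> f u = f u' -> u = u') &
    (forall v, B v -> exists2 u, A u & f u = v)].
Proof.
move=> Er Es Et H; have [rep Hrep] := class_representatives Er Es Et.
have [z k|f [AB finj fsurj]] := @colour_matching A B rep rep; last first.
  exists f; split=> // u /AB[Bf e]; split=> //; have [_ ->] := Hrep u; by rewrite e.
(* The colour of a number is the chosen representative of its class. A colour that does not
   represent itself is worn by no number, so both counts are empty. *)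
have [e|ne] := eqVneq (rep z) z.
  have sub C : (forall u, C u /\ rep u = z <-> C u /\ E u z).
    by move=> u; have [_ ->] := Hrep u; rewrite e.
  split=> h; have [h1 h2] := H z k.
    by apply: has_many_sub (h1 (has_many_sub _ h)) => u /sub.
  by apply: has_many_sub (h2 (has_many_sub _ h)) => u /sub.
have no C : forall u, ~ (C u /\ rep u = z).
  move=> u [_ e]; have [Eu _] := Hrep u; have := (Hrep u).2 (rep u).
  by case=> /(_ Eu) ee _; move: ne; rewrite -e -ee eqxx.
case: k => [|k]; first by split=> _; exists id.
by split=> -[w /(_ 0 isT)[/no]].
Qed.

(** * Isomorphism of subtrees *)

Lemma iso_sym D1 le1 D2 le2 : iso_structures D1 le1 D2 le2 -> iso_structures D2 le2 D1 le1.
Proof.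
case=> f [f12 finj fsurj fle].
have /functional_choice[g Hg] : forall z, exists x, D2 z -> D1 x /\ f x = z.
  by move=> z; have [/fsurj[x]|nD] := classic (D2 z); [exists x|exists 0].
exists g; split.
- by move=> z /Hg[].
- by move=> z z' /Hg[_ e] /Hg[_ e'] eg; rewrite -e -e' eg.
- by move=> x Dx; have [Dg e] := Hg _ (f12 x Dx); exists (f x); [apply: f12|apply: finj].
- by move=> z z' /Hg[Dz e] /Hg[Dz' e']; rewrite (fle _ _ Dz Dz') e e'.
Qed.

Lemma iso_trans D1 le1 D2 le2 D3 le3 : iso_structures D1 le1 D2 le2 ->
  iso_structures D2 le2 D3 le3 -> iso_structures D1 le1 D3 le3.
Proof.
case=> f [f12 finj fsurj fle] [g [g23 ginj gsurj gle]]; exists (g \o f); split=> /=.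
- by move=> x /f12/g23.
- by move=> x y Dx Dy /(ginj _ _ (f12 _ Dx) (f12 _ Dy)); apply: finj.
- by move=> z /gsurj[y /fsurj[x Dx <-] <-]; exists x.
- by move=> x y Dx Dy; rewrite (fle _ _ Dx Dy); apply: gle; apply: f12.
Qed.

Definition sprec (D : nat -> Prop) (le : nat -> nat -> Prop) (x y : nat) : Prop :=
  [/\ D x, D y, le x y & x <> y].

(** No root is demanded, so that disjoint sums of trees qualify. The bound on predecessors is a
    negated [has_many], hence Pi_1 when domain and order are Sigma_1. *)
Definition forest (N : nat) (D : nat -> Prop) (le : nat -> nat -> Prop) : Prop :=
  [/\ (forall x, D x -> le x x),
      (forall x y, D x -> D y -> le x y -> le y x -> x = y),
      (forall x y z, D x -> D y -> D z -> le x y -> le y z -> le x z),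
      (forall x y z, D x -> D y -> D z -> le y x -> le z x -> le y z \/ le z y) &
      (forall x, D x -> ~ has_many N.+1 (fun y => sprec D le y x))].

Section Forest.
Variables (N : nat) (D : nat -> Prop) (le : nat -> nat -> Prop).
Hypothesis F : forest N D le.

Notation lt := (sprec D le).

Let le_refl x : D x -> le x x. Proof. by case: F => H *; apply: H. Qed.
Let le_anti x y : D x -> D y -> le x y -> le y x -> x = y.
Proof. by case: F => _ H *; apply: H. Qed.
Let le_trans x y z : D x -> D y -> D z -> le x y -> le y z -> le x z.
Proof. by case: F => _ _ H _ _ Dx Dy Dz; apply: H. Qed.
Let le_linear x y z : D x -> D y -> D z -> le y x -> le z x -> le y z \/ le z y.
Proof. by case: F => _ _ _ H _ Dx Dy Dz; apply: H. Qed.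
Let lt_finite x : D x -> ~ has_many N.+1 (lt^~ x). Proof. by case: F => _ _ _ _ H; apply: H. Qed.

Let lt_irr x : ~ lt x x. Proof. by case=> _ _ _. Qed.

Let lt_le_trans x y z : D z -> lt x y -> le y z -> lt x z.
Proof.
move=> Dz [Dx Dy le1 ne] le2; split=> // [|e]; first exact: le_trans le1 le2.
by apply: ne; apply: le_anti; rewrite // e.
Qed.

Let lt_trans x y z : lt x y -> lt y z -> lt x z.
Proof. by move=> lt1 lt2; case: (lt2) => _ Dz le2 _; apply: lt_le_trans lt1 le2. Qed.

Definition childof (x u : nat) : Prop := lt x u /\ forall v, ~ (lt x v /\ lt v u).

(** Otherwise every [u] above [x] and at most [z] has another element strictly between [x] and [u];
    descending in this way from [z] yields more than [N] predecessors of [z]. *)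
Lemma child_below x z : lt x z -> exists u, childof x u /\ le u z.
Proof.
move=> lt_xz; apply: NNPP => no; have [_ Dz _ _] := lt_xz.
have between u : lt x u -> le u z -> exists v, lt x v /\ lt v u.
  move=> lt_xu le_uz; apply: NNPP => nv; apply: no; exists u; split=> //; split=> // v Hv.
  by apply: nv; exists v.
have chain k : exists u, [/\ lt x u, lt u z & has_many k (fun y => lt u y /\ lt y z)].
  elim: k => [|k [u [lt_xu lt_uz Hk]]].
    have [v [lt_xv lt_vz]] := between z lt_xz (le_refl Dz).
    by exists v; split=> //; exists id.
  have le_uz : le u z by case: lt_uz.
  have [v [lt_xv lt_vu]] := between u lt_xu le_uz.
  exists v; split=> //; first exact: lt_trans lt_vu lt_uz.
  apply: (has_manyS (b := u)) Hk; first by move=> y [lt_uy lt_yz]; split=> //; apply: lt_trans lt_vu lt_uy.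
    by split.
  by case=> /lt_irr.
have [u [_ _ Hu]] := chain N.+1; apply: (lt_finite Dz).
by apply: has_many_sub Hu => y [].
Qed.

Lemma child_uniq x u v z : D z -> childof x u -> childof x v -> le u z -> le v z -> u = v.
Proof.
move=> Dz [lt_xu min_u] [lt_xv min_v] le_uz le_vz.
have [_ Du _ _] := lt_xu; have [_ Dv _ _] := lt_xv.
apply: NNPP => ne; have [le_uv|le_vu] := le_linear Dz Du Dv le_uz le_vz.
  by apply: (min_v u); split=> //; split.
by apply: (min_u v); split=> //; split=> // /esym.
Qed.

Definition upset (x z : nat) : Prop := D z /\ le x z.

Notation iso x y := (iso_structures (upset x) le (upset y) le).

Lemma upset_refl x : D x -> upset x x. Proof. by move=> Dx; split; [|apply: le_refl]. Qed.

Lemma upset_trans x y z : D x -> upset x y -> upset y z -> upset x z.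
Proof. by move=> Dx [Dy le_xy] [Dz le_yz]; split=> //; apply: le_trans le_xy le_yz. Qed.

Lemma child_upset x u : childof x u -> upset x u.
Proof. by case=> [[Dx Du le_xu _] _]. Qed.

Lemma iso_children x y : D x -> D y -> iso x y ->
  exists f, [/\ (forall u, childof x u -> childof y (f u)),
    (forall u v, childof x u -> childof x v -> f u = f v -> u = v) &
    (forall u, childof x u -> iso u (f u))].
Proof.
move=> Dx Dy [f [fS finj fsurj fle]]; exists f.
have fx : f x = y.
  have [Dfx le_yfx] := fS x (upset_refl Dx).
  have [w Sw ew] := fsurj y (upset_refl Dy); apply: le_anti => //.
  by rewrite -ew; apply/(fle _ _ (upset_refl Dx) Sw); case: Sw.
have flt u v : upset x u -> upset x v -> lt u v <-> lt (f u) (f v).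
  move=> Su Sv; have [[Du _] [Dv _]] := (Su, Sv); have [[Dfu _] [Dfv _]] := (fS _ Su, fS _ Sv).
  split=> -[_ _ le_uv ne]; split=> //.
  - exact/(fle _ _ Su Sv).
  - by move/(finj _ _ Su Sv).
  - exact/(fle _ _ Su Sv).
  - by move=> e; apply: ne; rewrite e.
split=> [u Cu|u v /child_upset Su /child_upset Sv|u Cu]; last 2 first.
- exact: finj.
- have Su := child_upset Cu.
  have SS z : upset u z -> upset x z by apply: upset_trans.
  exists f; split=> [z Sz|z z' /SS Sz /SS Sz'|w [Dw le_fw]|z z' /SS Sz /SS Sz'].
  + by split; [case: (fS z (SS z Sz))|apply/(fle _ _ Su (SS z Sz)); case: Sz].
  + exact: finj.
  + have [_ le_yf] := fS u Su.
    have [z Sz ez] : exists2 z, upset x z & f z = w.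
      by apply: fsurj; split=> //; apply: le_trans le_yf le_fw; case: (fS u Su).
    exists z => //; split; first by case: Sz.
    by apply/(fle _ _ Su Sz); rewrite ez.
  + exact: fle.
- have Su := child_upset Cu; have Sx := upset_refl Dx; split.
    by rewrite -fx; apply/(flt _ _ Sx Su); case: Cu.
  move=> v [lt_yv lt_vf]; have [_ Dv le_yv _] := lt_yv.
  have [w Sw ew] : exists2 w, upset x w & f w = v by apply: fsurj.
  case: Cu => _ /(_ w); apply; split; [apply/(flt _ _ Sx Sw)|apply/(flt _ _ Sw Su)]; last by rewrite ew.
  by rewrite fx ew.
Qed.

Lemma iso_glue x y phi : D x -> D y ->
  (forall u, childof x u -> childof y (phi u) /\ iso u (phi u)) ->
  (forall u v, childof x u -> childof x v -> phi u = phi v -> u = v) ->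
  (forall v, childof y v -> exists2 u, childof x u & phi u = v) -> iso x y.
Proof.
move=> Dx Dy Hphi phi_inj phi_surj.
have /functional_choice[g Hg] : forall u, exists g, childof x u ->
    [/\ (forall z, upset u z -> upset (phi u) (g z)),
      (forall z z', upset u z -> upset u z' -> g z = g z' -> z = z'),
      (forall w, upset (phi u) w -> exists2 z, upset u z & g z = w) &
      (forall z z', upset u z -> upset u z' -> (le z z' <-> le (g z) (g z')))].
  move=> u; have [/Hphi[_ [g Hg]]|nC] := classic (childof x u); [by exists g|by exists id].
(* [cb z] is the child of [x] below [z]; it tells which of the chosen isomorphisms applies to
   [z]. *)
have /functional_choice[cb Hcb] : forall z, exists u, lt x z -> childof x u /\ upset u z.
  move=> z; have [lt_xz|nlt] := classic (lt x z); last by exists 0.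
  have [u [Cu le_uz]] := child_below lt_xz; exists u => _; split=> //.
  by split=> //; case: lt_xz.
pose f z := if z == x then y else g (cb z) z.
have fx : f x = y by rewrite /f eqxx.
have ltS z : upset x z -> z <> x -> lt x z by move=> [Dz le_xz] ne; split=> // /esym.
have fz z : upset x z -> z <> x ->
    [/\ f z = g (cb z) z, childof x (cb z), upset (cb z) z, childof y (phi (cb z)) & upset (phi (cb z)) (f z)].
  move=> Sz ne; have [Cz Scz] := Hcb z (ltS z Sz ne); rewrite /f; case: eqP => // _.
  by have [Cp _] := Hphi _ Cz; split=> //; have [gS _ _ _] := Hg _ Cz; apply: gS.
have f_ne z : upset x z -> z <> x -> lt y (f z).
  move=> Sz ne; have [_ _ _ [lt_yp _] [Df le_pf]] := fz z Sz ne.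
  exact: lt_le_trans lt_yp le_pf.
(* If the images are comparable, the images of both children lie below the larger one and coincide
   by [child_uniq]. So the glued map creates no comparabilities between different child subtrees. *)
have cb_eq z z' : upset x z -> z <> x -> upset x z' -> z' <> x -> le (f z) (f z') -> cb z = cb z'.
  move=> Sz ne Sz' ne' le_f; have [_ Cz _ Cp [Df le_pf]] := fz z Sz ne.
  have [_ Cz' _ Cp' [Df' le_pf']] := fz z' Sz' ne'.
  apply: phi_inj => //; apply: (child_uniq Df' Cp Cp') => //.
  by apply: le_trans le_pf le_f => //; case: Cp => -[].
have Sf z : upset x z -> upset y (f z).
  move=> Sz; have [->|ne] := classic (z = x); first by rewrite fx; apply: upset_refl.
  by have [_ Df le_yf _] := f_ne z Sz ne.
have fle z z' : upset x z -> upset x z' -> (le z z' <-> le (f z) (f z')).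
  move=> Sz Sz'; have [ez|ne] := classic (z = x).
    by rewrite ez fx; split=> _; [case: (Sf _ Sz')|case: Sz'].
  have [Dz le_xz] := Sz; have [Dz' le_xz'] := Sz'.
  have [ez'|ne'] := classic (z' = x).
    rewrite ez' fx; split=> [le_zx|le_fy]; first by case: ne; apply: le_anti.
    by have := lt_irr (lt_le_trans Dy (f_ne z Sz ne) le_fy).
  have [ef Cz Scz _ _] := fz z Sz ne; have [ef' Cz' Scz' _ _] := fz z' Sz' ne'.
  have [e|ne_cb] := classic (cb z = cb z').
    by have [_ _ _ gle] := Hg _ Cz; rewrite ef ef' -e; apply: gle => //; rewrite e.
  split=> [le_zz'|/cb_eq e]; last by case: ne_cb; apply: e.
  case: ne_cb; apply: (child_uniq Dz' Cz Cz'); last by case: Scz'.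
  by case: Scz => _ le_cz; apply: le_trans le_zz' => //; case: Cz => -[].
exists f; split=> // [z z' Sz Sz' e|w [Dw le_yw]].
  have [Df le_yf] := Sf z Sz.
  apply: le_anti; [by case: Sz|by case: Sz'| |].
    by apply/(fle _ _ Sz Sz'); rewrite -e; apply: le_refl.
  by apply/(fle _ _ Sz' Sz); rewrite -e; apply: le_refl.
have [->|ne] := classic (w = y); first by exists x => //; apply: upset_refl.
have lt_yw : lt y w by split=> // /esym.
have [v [Cv le_vw]] := child_below lt_yw; have [u Cu ev] := phi_surj v Cv.
have [_ _ gsurj _] := Hg u Cu; have [|z Sz ez] := gsurj w; first by rewrite ev.
have Sxz : upset x z by apply: upset_trans Sz => //; apply: child_upset.
have nex : z <> x.
  move=> e; case: Cu => lt_xu _; apply: (@lt_irr x); apply: lt_le_trans lt_xu _ => //.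
  by rewrite -e; case: Sz.
exists z => //; have [-> Cz Scz _ _] := fz z Sxz nex.
suff -> : cb z = u by [].
by case: Sz Scz => Dz le_uz [_ le_cz]; apply: (child_uniq Dz Cz Cu).
Qed.

Fixpoint height_le (m x : nat) : Prop :=
  if m is m'.+1 then forall u, childof x u -> height_le m' u else forall z, ~ lt x z.

(* For [m = 0] this is used at nodes of height at most 1, whose strict descendants are
   their children: dropping the universal quantifier saves one quantifier alternation. *)
Definition kid (m x u : nat) : Prop := lt x u /\ (m = 0 \/ forall v, ~ (lt x v /\ lt v u)).

(** [z] ranges over all numbers and merely names a class: [same_type m'] is an equivalence relation
    on all of them, whether or not they are nodes of suitable height. *)
Fixpoint same_type (m x y : nat) : Prop :=
  if m is m'.+1 then forall z k,
    has_many k (fun u => kid m' x u /\ same_type m' u z) <->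
    has_many k (fun u => kid m' y u /\ same_type m' u z)
  else True.

Lemma same_type_refl m x : same_type m x x.
Proof. by case: m. Qed.

Lemma same_type_sym m x y : same_type m x y -> same_type m y x.
Proof. by case: m => //= m H z k; rewrite H. Qed.

Lemma same_type_trans m x y z : same_type m x y -> same_type m y z -> same_type m x z.
Proof. by case: m => //= m H H' t k; rewrite H H'. Qed.

Lemma kidE m x u : height_le m.+1 x -> kid m x u <-> childof x u.
Proof.
move=> h; split=> [[lt_xu [e|min_u]]|[lt_xu min_u]]; [|by split|by split=> //; right].
subst m; have [v [Cv le_vu]] := child_below lt_xu.
suff -> : u = v by [].
apply: NNPP => ne; apply: (h v Cv u); split=> // [||/esym//]; first by case: Cv => -[].
by case: lt_xu.
Qed.

(** An isomorphism maps children injectively to children with isomorphic subtrees, so it preserves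
    their classes by induction; the inverse isomorphism gives the other half of each equivalence. *)
Lemma iso_same_type m x y : D x -> D y -> height_le m x -> height_le m y ->
  iso x y -> same_type m x y.
Proof.
elim: m x y => // m IH x y Dx Dy hx hy xy.
suff half x' y' : D x' -> D y' -> height_le m.+1 x' -> height_le m.+1 y' -> iso x' y' -> forall z k,
    has_many k (fun u => kid m x' u /\ same_type m u z) ->
    has_many k (fun u => kid m y' u /\ same_type m u z).
  by move=> z k; split; apply: half => //; apply: iso_sym.
move=> {x y Dx Dy hx hy xy}Dx Dy hx hy xy z k.
have [f [fC finj fiso]] := iso_children Dx Dy xy.
apply: (has_many_map (f := f)) => [u [/(kidE _ hx) Cu uz]|u v [/(kidE _ hx) Cu _] [/(kidE _ hx) Cv _]]; last exact: finj.
split; first exact/(kidE _ hy)/fC.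
apply: same_type_trans uz; apply: same_type_sym; apply: IH; last exact: fiso.
- by case: (Cu) => -[].
- by case: (fC u Cu) => -[].
- exact: hx.
- exact/hy/fC.
Qed.

(** Equal counts in every class give a class-preserving bijection between the children; by induction
    matched children carry isomorphic subtrees, and these isomorphisms are glued. *)
Lemma same_type_iso m x y : D x -> D y -> height_le m x -> height_le m y ->
  same_type m x y -> iso x y.
Proof.
elim: m x y => [|m IH] x y Dx Dy hx hy xy.
  have S1 x' z : height_le 0 x' -> upset x' z -> D x' -> z = x'.
    move=> h [Dz le_xz] Dx'; apply: NNPP => ne; apply: (h z); split=> // /esym//.
  exists (fun=> y); split.
  - by move=> z _; apply: upset_refl.
  - by move=> z z' Sz Sz' _; rewrite (S1 _ _ hx Sz) // (S1 _ _ hx Sz').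
  - by move=> z Sz; exists x; [apply: upset_refl|rewrite (S1 _ _ hy Sz)].
  - by move=> z z' Sz Sz'; rewrite (S1 _ _ hx Sz) // (S1 _ _ hx Sz') //; split=> _; apply: le_refl.
have [f [fC finj fsurj]] :=
  class_matching (@same_type_refl m) (@same_type_sym m) (@same_type_trans m) xy.
apply: (iso_glue (phi := f)) => // [u /(kidE _ hx) Ku|u v /(kidE _ hx) Ku /(kidE _ hx) Kv|v /(kidE _ hy)/fsurj[u Ku <-]].
- have [/(kidE _ hy) Cf st] := fC u Ku; split=> //.
  have /(kidE _ hx) Cu := Ku.
  apply: IH st; [by case: Cu => -[]|by case: Cf => -[]|exact: hx|exact: hy].
- exact: finj.
- by exists u => //; apply/(kidE _ hx).
Qed.

Lemma height_leP n m j x : D x -> j + m = n -> (forall z, D z -> ~ has_many n.+1 (lt^~ z)) ->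
  has_many j (lt^~ x) -> height_le m x.
Proof.
move=> Dx e Hn; elim: m j x Dx e => [|m IH] j x Dx e Hj /= z.
  move=> lt_xz; have [_ Dz _ _] := lt_xz; apply: (Hn z Dz).
  have <- : j = n by lia.
  apply: (has_manyS (b := x)) Hj => [u lt_ux|//|/lt_irr//]; exact: lt_trans lt_ux lt_xz.
move=> [lt_xz _]; have [_ Dz _ _] := lt_xz; apply: (IH j.+1) => //; first by lia.
apply: (has_manyS (b := x)) Hj => [u lt_ux|//|/lt_irr//]; exact: lt_trans lt_ux lt_xz.
Qed.

End Forest.

(** * The isomorphism problem is in Pi_2n *)

(** Trades the quantifier over functions for a number quantifier over coded lists. *)
Lemma has_many_lnth k A : has_many k A <-> exists S, forall i, i < k ->
  A (lnth S i) /\ forall j, j < i -> lnth S j <> lnth S i.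
Proof.
split=> [[w Hw]|[S HS]]; last by exists (lnth S).
exists (lc (mkseq w k)) => i lt_i; have [Ai ne] := Hw i lt_i.
rewrite !lnth_lc nth_mkseq //; split=> // j lt_j.
by rewrite lnth_lc nth_mkseq ?(ltn_trans lt_j) //; apply: ne.
Qed.

Lemma ar_has_many m (A : nat -> nat -> Prop) k : cfun k ->
  ar m.+1 true (fun c => A (pi1 c) (pi2 c)) -> ar m.+1 true (fun x => has_many (k x) (A^~ x)).
Proof.
move=> ck aA.
apply: (@ar_ext _ _ (fun x => exists S, forall i, i < k x ->
  A (lnth S i) x /\ forall j, j < i -> lnth S j <> lnth S i)); last by move=> x; rewrite has_many_lnth.
ar_tac.
pose f c := cpair (lnth (pi1 (pi2 c)) (pi1 c)) (pi2 (pi2 c)).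
have cf : cfun f by rewrite /f; comp_list_tac.
by apply: ar_ext (ar_sub cf aA) _ => c; rewrite /f !pi_cpairE.
Qed.

Section Uniform.
Variables (D : nat -> nat -> Prop) (le : nat -> nat -> nat -> Prop).
Hypothesis aD : forall f g, cfun f -> cfun g -> ar 1 true (fun x => D (f x) (g x)).
Hypothesis ale : forall f g h, cfun f -> cfun g -> cfun h -> ar 1 true (fun x => le (f x) (g x) (h x)).

Lemma ar_sprec f g h : cfun f -> cfun g -> cfun h ->
  ar 1 true (fun x => sprec (D (f x)) (le (f x)) (g x) (h x)).
Proof.
move=> cf cg ch.
apply: (@ar_ext _ _ (fun x => D (f x) (g x) /\ D (f x) (h x) /\ le (f x) (g x) (h x) /\ g x <> h x)).
  by ar_tac; [exact: aD|exact: aD|exact: ale].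
by move=> x; split=> [[? [? []]]|[]]; split.
Qed.

(** In the step, each [has_many] is Sigma_(2m+1): [same_type m] is Pi_2m, and immediate succession
    costs Pi_1, which fits unless [m = 0], where [kid] amounts to the Sigma_1 relation [sprec]. The
    equivalence of two such statements is Pi_(2m+2), and the quantifiers over [z] and [k] are
    absorbed. *)
Lemma ar_same_type m f g h : cfun f -> cfun g -> cfun h ->
  ar m.*2 false (fun x => same_type (D (f x)) (le (f x)) m (g x) (h x)).
Proof.
elim: m f g h => [|m IH] f g h cf cg ch; first by apply: ar_recp; exists (fun=> 0); split; [exact: comp_const|].
have side g' : cfun g' -> ar m.*2.+1 true (fun t =>
    has_many (pi1 t) (fun u => kid (D (f (pi2 (pi2 t)))) (le (f (pi2 (pi2 t)))) m (g' (pi2 (pi2 t))) u /\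
      same_type (D (f (pi2 (pi2 t)))) (le (f (pi2 (pi2 t)))) m u (pi1 (pi2 t)))).
  move=> cg'; apply: ar_has_many; first by comp_tac.
  apply: ar_and; last first.
    by apply: (@ar_lift m.*2 false) => //; apply: IH; comp_tac.
  rewrite /kid; case: m IH => [|m] IH.
    have a : ar 1 true (fun c => sprec (D (f (pi2 (pi2 (pi2 c))))) (le (f (pi2 (pi2 (pi2 c))))) (g' (pi2 (pi2 (pi2 c)))) (pi1 c)).
      by apply: ar_sprec; comp_tac.
    by apply: ar_ext a _ => c; split=> [|[]//]; split=> //; left.
  apply: ar_and; first by apply: (@ar_lift 1 true) => //; apply: ar_sprec; comp_tac.
  apply: ar_or; first by ar_tac.
  apply: (@ar_lift 1 false) => //; ar_tac; apply: ar_sprec; comp_tac.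
rewrite doubleS /=; ar_tac.
by apply: ar_iff (side g cg) (side h ch); rewrite ltnSn.
Qed.
End Uniform.

(** Asking directly for a root puts an existential quantifier before a universal one and leaves
    Pi_2. In a forest with bounded levels it can be replaced by nonemptiness and common lower
    bounds, both Pi_2. *)
Definition tree_cond (n : nat) (D : nat -> Prop) (le : nat -> nat -> Prop) : Prop :=
  [/\ forest n D le, exists x, D x &
      forall x y, D x -> D y -> exists z, D z /\ le z x /\ le z y].

Lemma finite_enum n A : ~ has_many n.+1 A ->
  exists s : seq nat, [/\ uniq s, size s <= n & forall y, y \in s <-> A y].
Proof.
elim: n => [|n IH] nA.
  exists [::]; split=> // y; split=> // Ay; case: nA.
  by exists (fun=> y) => -[].
have [[w Hw]|/IH[s [us le_s Hs]]] := classic (has_many n.+1 A); last first.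
  by exists s; split=> //; apply: leqW.
have w_inj i j : i < n.+1 -> j < n.+1 -> w i = w j -> i = j.
  move=> lt_i lt_j e; case: (ltngtP i j) => // lt_ij.
    by case: (Hw j lt_j) => _ /(_ _ lt_ij)/(_ e).
  by case: (Hw i lt_i) => _ /(_ _ lt_ij)/(_ (esym e)).
exists (mkseq w n.+1); split; rewrite ?size_mkseq //.
  by rewrite map_inj_in_uniq ?iota_uniq // => i j; rewrite !mem_iota; apply: w_inj.
have sA y : y \in mkseq w n.+1 -> A y.
  by case/mapP=> i; rewrite mem_iota => lt_i ->; case: (Hw i lt_i).
move=> y; split=> [/sA//|Ay]; apply/negPn/negP => ny; apply: nA.
apply: (@has_manyS _ (fun y => y \in mkseq w n.+1) A y) => //; first exact/negP.
exists w => i lt_i; have [_ ne] := Hw i lt_i; split=> //.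
by apply/mapP; exists i; rewrite ?mem_iota.
Qed.

Lemma enum_finite n A (s : seq nat) : size s <= n -> (forall y, A y -> y \in s) -> ~ has_many n.+1 A.
Proof.
move=> le_s sA [w Hw].
have: size (mkseq w n.+1) <= size s; last by rewrite size_mkseq => h; have := leq_trans h le_s; rewrite ltnn.
apply: uniq_leq_size.
  rewrite map_inj_in_uniq ?iota_uniq // => i j; rewrite !mem_iota => lt_i lt_j e.
  case: (ltngtP i j) => // lt_ij.
    by case: (Hw j lt_j) => _ /(_ _ lt_ij)/(_ e).
  by case: (Hw i lt_i) => _ /(_ _ lt_ij)/(_ (esym e)).
by move=> y /mapP[i]; rewrite mem_iota => lt_i ->; apply: sA; case: (Hw i lt_i).
Qed.

(** A node with the fewest predecessors is minimal, since a predecessor would have fewer still; and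
    a minimal node is its own common lower bound with any other node. *)
Lemma tree_cond_root n D le : tree_cond n D le -> exists r, D r /\ forall x, D x -> le r x.
Proof.
move=> [F [x0 Dx0] lower]; have [le_refl le_anti le_tr _ fin] := F.
have [k [[r [Dr nr]] min_k]] :
    exists k, (exists y, D y /\ ~ has_many k.+1 (fun z => sprec D le z y)) /\
      forall k', (exists y, D y /\ ~ has_many k'.+1 (fun z => sprec D le z y)) -> k <= k'.
  by apply: least_ex; exists n, x0; split=> //; apply: fin.
have minr z : ~ sprec D le z r.
  move=> lt_zr; case: k nr min_k => [|k] nr min_k.
    by apply: nr; exists (fun=> z) => -[].
  have [Dz _ le_zr ne] := lt_zr.
  suff /min_k : exists y, D y /\ ~ has_many k.+1 (fun z => sprec D le z y) by rewrite ltnn.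
  exists z; split=> // h; apply: nr; apply: (has_manyS (b := z)) h => [u [Du _ le_uz nu]|//|[]//].
  split=> // [|e]; first exact: le_tr le_uz le_zr.
  by apply: nu; apply: le_anti => //; rewrite e.
exists r; split=> // x Dx; have [z [Dz [le_zr le_zx]]] := lower r x Dr Dx.
suff <- : z = r by [].
by apply: NNPP => ne; apply: (minr z); split.
Qed.

Lemma tree_condP n D le : tree_height_le n D le <-> tree_cond n D le.
Proof.
split=> [[le_refl le_anti le_tr [r [Dr le_r]] pred]|T].
  split; [split=> //| by exists r|by move=> x y Dx Dy; exists r; do !split=> //; apply: le_r].
    by move=> x y z Dx Dy Dz le_yx le_zx; have [lin _] := pred x Dx; apply: lin.
  move=> x Dx; have [_ [s [us le_s Hs]]] := pred x Dx.
  by apply: (enum_finite le_s) => y [Dy _ le_yx ne]; apply/Hs.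
have [[le_refl le_anti le_tr lin fin] _ _] := T.
split=> //; first exact: tree_cond_root T.
move=> x Dx; split=> [y z|]; first exact: lin.
have [s [us le_s Hs]] := finite_enum (fin x Dx); exists s; split=> // y; rewrite Hs.
by split=> [[]//|[Dy [le_yx ne]]].
Qed.

(** * Disjoint sums of trees *)

Definition sum_dom (D : nat -> nat -> Prop) (x : nat) : Prop := D (pi1 x) (pi2 x).

Definition sum_le (le : nat -> nat -> nat -> Prop) (x y : nat) : Prop :=
  pi1 x = pi1 y /\ le (pi1 x) (pi2 x) (pi2 y).

Lemma pi_inj x y : pi1 x = pi1 y -> pi2 x = pi2 y -> x = y.
Proof. by move=> e1 e2; rewrite -[x]cpair_pi e1 e2 cpair_pi. Qed.

Lemma sprec_sum D le u x : sprec (sum_dom D) (sum_le le) u x <->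
  pi1 u = pi1 x /\ sprec (D (pi1 x)) (le (pi1 x)) (pi2 u) (pi2 x).
Proof.
rewrite /sum_dom /sum_le; split=> [[Du Dx [e le_ux] ne]|[e [Du Dx le_ux ne]]].
  by rewrite e in Du le_ux; split=> //; split=> // e2; apply: ne; apply: pi_inj.
by split; rewrite ?e // => e2; apply: ne; rewrite e2.
Qed.

Lemma sum_forest n D le : (forall i, forest n (D i) (le i)) -> forest n (sum_dom D) (sum_le le).
Proof.
move=> F; rewrite /sum_dom /sum_le; split.
- by move=> x Dx; have [r _ _ _ _] := F (pi1 x); split=> //; apply: r.
- move=> x y Dx Dy [e le_xy] [_ le_yx]; have [_ a _ _ _] := F (pi1 x).
  by apply: pi_inj => //; rewrite -e in Dy le_yx; apply: a.
- move=> x y z Dx Dy Dz [e le_xy] [e' le_yz]; have [_ _ t _ _] := F (pi1 x).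
  rewrite -e' -e in Dz; rewrite -e in Dy le_yz; split; first by rewrite e.
  exact: t le_xy le_yz.
- move=> x y z Dx Dy Dz [e le_yx] [e' le_zx]; have [_ _ _ l _] := F (pi1 x).
  rewrite e in Dy le_yx; rewrite e' in Dz le_zx; rewrite e e'.
  by have [le_yz|le_zy] := l _ _ _ Dx Dy Dz le_yx le_zx; [left|right].
- move=> x Dx H; have [_ _ _ _ f] := F (pi1 x); apply: (f _ Dx).
  apply: (has_many_map (f := pi2)) H => [u /sprec_sum[]//|u v /sprec_sum[eu _] /sprec_sum[ev _]].
  by apply: pi_inj; rewrite eu ev.
Qed.

Lemma sum_iso n D le i r : (forall i, forest n (D i) (le i)) -> D i r -> (forall x, D i x -> le i r x) ->
  iso_structures (D i) (le i) (upset (sum_dom D) (sum_le le) (cpair i r)) (sum_le le).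
Proof.
move=> F Dr le_r; exists (cpair i); rewrite /upset /sum_dom /sum_le; split.
- by move=> x Dx; rewrite !pi_cpairE; do !split=> //; apply: le_r.
- by move=> x y _ _ /cpair_inj[].
- by move=> z [Dz []]; rewrite !pi_cpairE => e; rewrite -e in Dz *; exists (pi2 z) => //; rewrite e cpair_pi.
- by move=> x y _ _; rewrite !pi_cpairE; split=> [|[]].
Qed.

(** Singles out the roots at a lower cost than lying below all elements: over Sigma_1 data it is
    Sigma_2, so it may stand as a hypothesis in a Pi_2 statement. *)
Definition minimal D le x := D x /\ forall z : nat, ~ sprec D le z x.

Lemma tree_cond_minimal n D le x : tree_cond n D le ->
  minimal D le x <-> D x /\ forall y, D y -> le x y.
Proof.
move=> T; have [r [Dr le_r]] := tree_cond_root T; have [[_ le_anti le_tr _ _] _ _] := T.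
split=> [[Dx min_x]|[Dx le_x]]; split=> //.
  suff <- : r = x by [].
  by apply: NNPP => ne; apply: (min_x r); split=> //; apply: le_r.
by move=> z [Dz _ le_zx ne]; apply: ne; apply: le_anti => //; apply: le_x.
Qed.

Lemma sum_minimal n D le x : (forall i, tree_cond n (D i) (le i)) ->
  minimal (sum_dom D) (sum_le le) x <-> D (pi1 x) (pi2 x) /\ forall y, D (pi1 x) y -> le (pi1 x) (pi2 x) y.
Proof.
move=> T; rewrite -(tree_cond_minimal _ (T (pi1 x))).
split=> -[Dx min_x]; split=> // z; last by move/sprec_sum=> [_ /min_x].
by move=> lt; apply: (min_x (cpair (pi1 x) z)); apply/sprec_sum; rewrite !pi_cpairE.
Qed.

(** Each summand has exactly one root, so the roots can be introduced by universal quantifiers,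
    which keeps the condition on the Pi side. *)
Lemma iso_same_type_sum n D le : (forall i, tree_cond n (D i) (le i)) ->
  iso_structures (D 0) (le 0) (D 1) (le 1) <->
  forall x y, minimal (sum_dom D) (sum_le le) x -> minimal (sum_dom D) (sum_le le) y ->
    pi1 x = 0 -> pi1 y = 1 -> same_type (sum_dom D) (sum_le le) n x y.
Proof.
move=> T; have F i : forest n (D i) (le i) by case: (T i).
have SF := sum_forest F.
have height x : minimal (sum_dom D) (sum_le le) x -> height_le (sum_dom D) (sum_le le) n x.
  move=> [Dx _]; apply: (height_leP (n := n) (j := 0) SF) => //; last by exists id.
  by case: SF.
split=> [iso x y mx my ex ey|H].
  have [[Dx lex] [Dy ley]] := ((sum_minimal x T).1 mx, (sum_minimal y T).1 my).
  apply: (iso_same_type SF); [exact: Dx|exact: Dy|exact: height|exact: height|].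
  rewrite ex in Dx lex; rewrite ey in Dy ley.
  have isox := sum_iso F Dx lex; have isoy := sum_iso F Dy ley.
  rewrite -[x]cpair_pi -[y]cpair_pi ex ey.
  exact: iso_trans (iso_sym isox) (iso_trans iso isoy).
have [r [Dr le_r]] := tree_cond_root (T 0); have [r' [Dr' le_r']] := tree_cond_root (T 1).
have m0 : minimal (sum_dom D) (sum_le le) (cpair 0 r) by apply/(sum_minimal _ T); rewrite !pi_cpairE.
have m1 : minimal (sum_dom D) (sum_le le) (cpair 1 r') by apply/(sum_minimal _ T); rewrite !pi_cpairE.
have st := H _ _ m0 m1 (pi1_cpair _ _) (pi1_cpair _ _).
have isox := sum_iso F Dr le_r; have isoy := sum_iso F Dr' le_r'.
apply: iso_trans isox (iso_trans _ (iso_sym isoy)).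
by apply: (same_type_iso SF) st; [case: m0|case: m1|exact: height|exact: height].
Qed.

(** * Structures given by pairs of program codes *)

Definition dom_of (d x : nat) : Prop := prog_eval (pi1 d) (lc [:: x]) 1.
Definition ord_of (d x y : nat) : Prop := prog_eval (pi2 d) (lc [:: x; y]) 1.

Definition total_codes (d : nat) : Prop :=
  (forall x, dom_of d x \/ prog_eval (pi1 d) (lc [:: x]) 0) /\
  (forall x y, ord_of d x y \/ prog_eval (pi2 d) (lc [:: x; y]) 0).

Lemma prog_eval_unique a p xs y : prog a = Some p -> prog_eval a (lc xs) y <-> eval p xs y.
Proof. by move=> pa; rewrite prog_evalP; split=> [[q]|ev]; [rewrite pa => -[->]|exists p]. Qed.

Lemma total_codesP a b : total_codes (cpair a b) <->
  exists d r, [/\ prog a = Some d, prog b = Some r,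
    decides1 d (dom_of (cpair a b)) & decides2 r (ord_of (cpair a b))].
Proof.
rewrite /total_codes /dom_of /ord_of !pi_cpairE; split=> [[Ha Hb]|[d [r [ed er Hd Hr]]]]; last first.
  split=> [x|x y].
    by have [[H _]|[_ /(prog_eval_unique _ _ ed)]] := Hd x; [left|right].
  by have [[H _]|[_ /(prog_eval_unique _ _ er)]] := Hr x y; [left|right].
have [d ed] : exists d, prog a = Some d by have [/prog_evalP[d]|/prog_evalP[d]] := Ha 0; exists d.
have [r er] : exists r, prog b = Some r by have [/prog_evalP[r]|/prog_evalP[r]] := Hb 0 0; exists r.
exists d, r; split=> // [x|x y].
  rewrite !(prog_eval_unique _ _ ed); have := Ha x; rewrite !(prog_eval_unique _ _ ed) => -[ev|ev].
    by left.
  by right; split=> // ev1; have := eval_fun ev ev1.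
rewrite !(prog_eval_unique _ _ er); have := Hb x y; rewrite !(prog_eval_unique _ _ er) => -[ev|ev].
  by left.
by right; split=> // ev1; have := eval_fun ev ev1.
Qed.

(** Index 0 gives the first structure and every other index the second, so that conditions can be
    imposed for all [i] at once. *)
Definition select (c i : nat) : nat := (1 - i) * pi1 c + (1 - (1 - i)) * pi2 c.

Lemma IsoTreeProblemE n c : IsoTreeProblem n c <->
  [/\ (forall i, total_codes (select c i)),
      (forall i, tree_cond n (dom_of (select c i)) (ord_of (select c i))) &
      forall x y, let D := sum_dom (fun i => dom_of (select c i)) in
        let le := sum_le (fun i => ord_of (select c i)) in
        minimal D le x -> minimal D le y -> pi1 x = 0 -> pi1 y = 1 -> same_type D le n x y].
Proof.
have s0 x y : select (cpair x y) 0 = x by rewrite /select !pi_cpairE; lia.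
have s1 x y i : select (cpair x y) i.+1 = y by rewrite /select !pi_cpairE; lia.
(* By determinism of evaluation the programs determine the sets they decide, which removes the
   quantifiers over sets from the problem. *)
have codes D le a b d r : prog a = Some d -> prog b = Some r -> decides1 d D -> decides2 r le ->
    D = dom_of (cpair a b) /\ le = ord_of (cpair a b).
  move=> ed er Hd Hr; rewrite /dom_of /ord_of !pi_cpairE; split.
    apply: functional_extensionality => x; apply: propositional_extensionality.
    rewrite (prog_eval_unique _ _ ed); have [[Dx ev]|[nDx ev]] := Hd x; split=> // ev1.
    by have := eval_fun ev ev1.
  apply: functional_extensionality => x; apply: functional_extensionality => y.
  apply: propositional_extensionality.
  rewrite (prog_eval_unique _ _ er); have [[Dx ev]|[nDx ev]] := Hr x y; split=> // ev1.
  by have := eval_fun ev ev1.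
split.
  case=> a1 [b1 [a2 [b2 [d1 [r1 [d2 [r2 [D1 [D2 [le1 [le2]]]]]]]]]]].
  move=> [-> [ed1 [er1 [ed2 [er2 [Hd1 [Hr1 [Hd2 [Hr2 [T1 [T2 iso]]]]]]]]]]].
  have [e1 e2] := codes _ _ _ _ _ _ ed1 er1 Hd1 Hr1; have [e3 e4] := codes _ _ _ _ _ _ ed2 er2 Hd2 Hr2.
  subst D1 le1 D2 le2.
  have T i : tree_cond n (dom_of (select (cpair (cpair a1 b1) (cpair a2 b2)) i))
      (ord_of (select (cpair (cpair a1 b1) (cpair a2 b2)) i)).
    by case: i => [|i]; rewrite ?s0 ?s1; apply/tree_condP.
  split=> //; last by apply/(iso_same_type_sum T); rewrite s0 s1.
  by case=> [|i]; rewrite ?s0 ?s1; apply/total_codesP; [exists d1, r1|exists d2, r2].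
rewrite -(cpair_pi c) -(cpair_pi (pi1 c)) -(cpair_pi (pi2 c)).
set a1 := pi1 (pi1 c); set b1 := pi2 (pi1 c); set a2 := pi1 (pi2 c); set b2 := pi2 (pi2 c).
move=> [tot T /(iso_same_type_sum T)]; rewrite s0 s1 => iso.
have := tot 0; rewrite s0 => /total_codesP[d1 [r1 [ed1 er1 Hd1 Hr1]]].
have := tot 1; rewrite s1 => /total_codesP[d2 [r2 [ed2 er2 Hd2 Hr2]]].
exists a1, b1, a2, b2, d1, r1, d2, r2.
exists (dom_of (cpair a1 b1)), (dom_of (cpair a2 b2)), (ord_of (cpair a1 b1)), (ord_of (cpair a2 b2)).
have := T 0; rewrite s0 => /tree_condP; have := T 1; rewrite s1 => /tree_condP.
by move=> t2 t1; repeat (split=> //).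
Qed.

Section UniformTree.
Variables (D : nat -> nat -> Prop) (le : nat -> nat -> nat -> Prop).
Hypothesis aD : forall f g, cfun f -> cfun g -> ar 1 true (fun x => D (f x) (g x)).
Hypothesis ale : forall f g h, cfun f -> cfun g -> cfun h -> ar 1 true (fun x => le (f x) (g x) (h x)).

Let aD2 s f g : cfun f -> cfun g -> ar 2 s (fun x => D (f x) (g x)).
Proof. by move=> cf cg; apply: (@ar_lift 1 true) => //; apply: aD. Qed.

Let ale2 s f g h : cfun f -> cfun g -> cfun h -> ar 2 s (fun x => le (f x) (g x) (h x)).
Proof. by move=> cf cg ch; apply: (@ar_lift 1 true) => //; apply: ale. Qed.

Lemma ar_tree_cond n f : cfun f -> ar 2 false (fun x => tree_cond n (D (f x)) (le (f x))).
Proof.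
move=> cf.
apply: (@ar_ext _ _ (fun x =>
  (forall y, D (f x) y -> le (f x) y y) /\
  (forall y z, D (f x) y -> D (f x) z -> le (f x) y z -> le (f x) z y -> y = z) /\
  (forall y z t, D (f x) y -> D (f x) z -> D (f x) t -> le (f x) y z -> le (f x) z t -> le (f x) y t) /\
  (forall y z t, D (f x) y -> D (f x) z -> D (f x) t -> le (f x) z y -> le (f x) t y -> le (f x) z t \/ le (f x) t z) /\
  (forall y, D (f x) y -> ~ has_many n.+1 (fun z => sprec (D (f x)) (le (f x)) z y)) /\
  (exists y, D (f x) y) /\
  (forall y z, D (f x) y -> D (f x) z -> exists t, D (f x) t /\ le (f x) t y /\ le (f x) t z))).
  ar_tac; try by (apply: aD2 || apply: ale2); comp_tac.
  - apply: (@ar_lift 1 true) => //; apply: ar_has_many; first by comp_tac.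
    by apply: (ar_sprec aD ale); comp_tac.
  - by apply: (@ar_lift 1 true) => //; ar_tac; apply: aD; comp_tac.
  - by apply: (@ar_lift 1 true) => //; ar_tac; (apply: aD || apply: ale); comp_tac.
move=> x; split=> [[H1 [H2 [H3 [H4 [H5 [H6 H7]]]]]]|[[H1 H2 H3 H4 H5] H6 H7]]; by do !split.
Qed.
End UniformTree.

Lemma comp_select f g : cfun f -> cfun g -> cfun (fun x => select (f x) (g x)).
Proof. by move=> cf cg; rewrite /select; comp_tac. Qed.

Lemma ar_dom_of m s f g : 0 < m -> (m = 1 -> s = true) -> cfun f -> cfun g ->
  ar m s (fun x => dom_of (f x) (g x)).
Proof. by move=> m_gt0 ms cf cg; rewrite /dom_of /=; apply: ar_prog_eval => //; comp_list_tac. Qed.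

Lemma ar_ord_of m s f g h : 0 < m -> (m = 1 -> s = true) -> cfun f -> cfun g -> cfun h ->
  ar m s (fun x => ord_of (f x) (g x) (h x)).
Proof. by move=> m_gt0 ms cf cg ch; rewrite /ord_of /=; apply: ar_prog_eval => //; comp_list_tac. Qed.

Lemma ar_total_codes f : cfun f -> ar 2 false (fun x => total_codes (f x)).
Proof.
move=> cf; rewrite /total_codes /=; ar_tac; first [apply: ar_dom_of|apply: ar_ord_of|apply: ar_prog_eval] => //; comp_list_tac.
Qed.

(** Totality of the programs and the tree conditions are Pi_2, which fits as [n] is positive; the
    hypotheses [minimal] are Sigma_2n, and their conclusion [same_type] is Pi_2n. *)
Lemma Pi0_IsoTreeProblem n : 0 < n -> Pi0_set (2 * n) (IsoTreeProblem n).
Proof.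
move=> n_gt0; apply/Pi0_setP; rewrite mul2n.
have lift P : ar 2 false P -> ar n.*2 false P.
  move=> a2; case: n n_gt0 => [//|[|n]] _ //.
  by apply: (@ar_lift 2 false) => //; rewrite doubleS; lia.
pose D c := sum_dom (fun i => dom_of (select c i)).
pose le c := sum_le (fun i => ord_of (select c i)).
have aD f g : cfun f -> cfun g -> ar 1 true (fun x => D (f x) (g x)).
  move=> cf cg; rewrite /D /sum_dom; apply: ar_dom_of => //; last by comp_tac.
  by apply: comp_select; comp_tac.
have ale f g h : cfun f -> cfun g -> cfun h -> ar 1 true (fun x => le (f x) (g x) (h x)).
  move=> cf cg ch; rewrite /le /sum_le; apply: ar_and; first by ar_tac.
  by apply: ar_ord_of => //; comp_tac; apply: comp_select; comp_tac.
have amin f g : cfun f -> cfun g -> ar n.*2 true (fun x => minimal (D (f x)) (le (f x)) (g x)).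
  move=> cf cg; apply: ar_and.
    by apply: (@ar_lift 1 true); [lia|apply: aD].
  apply: (@ar_lift 1 false); first by lia.
  by ar_tac; apply: (ar_sprec aD ale); comp_tac.
apply: (@ar_ext _ _ (fun c => (forall i, total_codes (select c i)) /\
  (forall i, tree_cond n (dom_of (select c i)) (ord_of (select c i))) /\
  forall x y, minimal (D c) (le c) x -> minimal (D c) (le c) y -> pi1 x = 0 -> pi1 y = 1 ->
    same_type (D c) (le c) n x y)); last first.
  by move=> c; rewrite IsoTreeProblemE; split=> [[? []]|[]].
apply: ar_and; first by apply: lift; apply: ar_all; apply: ar_total_codes; apply: comp_select; comp_tac.
apply: ar_and.
  apply: lift; apply: ar_all; apply: (@ar_tree_cond dom_of ord_of) => [f g cf cg|f g h cf cg ch|].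
  - exact: ar_dom_of.
  - exact: ar_ord_of.
  - by apply: comp_select; comp_tac.
case: n n_gt0 lift amin => // n _ _ amin; rewrite doubleS in amin *.
ar_tac; try by apply: amin; comp_tac.
by rewrite -doubleS; apply: (ar_same_type aD ale); comp_tac.
Qed.

(** * A normal form for Pi_2m sets *)

Definition infinitely (A : nat -> Prop) : Prop := forall N, exists w, N <= w /\ A w.

Lemma size_of_ldrop l z : ldrop l z = 0 -> (forall i, i < z -> ldrop l i <> 0) ->
  exists2 xs, l = lc xs & size xs = z.
Proof.
have [xs ->] := lc_surj l => l0 ln; exists xs => //.
apply/eqP; rewrite eqn_leq; apply/andP; split.
  by rewrite leqNgt; apply/negP => /ldrop_neq0; rewrite l0.
by rewrite leqNgt; apply/negP => lt_z; have /ldrop_neq0 := ln _ lt_z; rewrite ltnn.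
Qed.

(* The unique witness is the least [z] together with the list of the least
   refutations of [Q] at the smaller numbers. *)
Lemma unique_witness m Q : ar m.*2 false Q -> exists Q', [/\ ar m.*2 false Q',
  (forall x w w', Q' (cpair w x) -> Q' (cpair w' x) -> w = w') &
  (forall x, (exists z, Q (cpair z x)) <-> exists w, Q' (cpair w x))].
Proof.
move=> aQ.
(* [N (cpair a u)] says that [a] refutes [Q] at [u]. For positive [m] it is the negation of the
   matrix of [Q], one level down, so that both it and the absence of smaller refutations stay within
   Pi_2m; for [m = 0] everything is recursive. *)
have [N [nQ aN aN']] : exists N, [/\ (forall u, ~ Q u <-> exists a, N (cpair a u)),
    ar m.*2 false N & ar m.*2 false (fun t => forall a, a < pi1 t -> ~ N (cpair a (pi2 t)))].
  case: m aQ => [|m] aQ.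
    have aN : ar 0 false (fun c => ~ Q (pi2 c)).
      by apply: ar_neg; apply: (ar_sub _ aQ); comp_tac.
    exists (fun c => ~ Q (pi2 c)); split=> //.
      by move=> u; split=> [nQ|[a]]; rewrite ?pi_cpairE //; exists 0; rewrite pi_cpairE.
    apply: (@ar_ball 0 false (fun a t => ~ ~ Q (pi2 (cpair a (pi2 t))))); first by comp_tac.
    by apply: ar_neg; apply: (ar_sub _ aN); comp_tac.
  have [Q1 [aQ1 HQ]] := aQ; have {}aQ1 : ar m.*2.+1 true Q1 by exact: aQ1.
  exists (fun c => ~ Q1 c); split.
  - move=> u; rewrite HQ; split=> [/not_all_ex_not//|[a nQ1] /(_ a)//].
  - by apply: (@ar_lift m.*2.+1 false) => //; exact: (@ar_not _ true).
  - apply: (@ar_lift m.*2.+1 true) => //.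
    apply: (@ar_ball _ true (fun a t => ~ ~ Q1 (cpair a (pi2 t)))); first by comp_tac.
    apply: ar_neg; apply: ar_neg; apply: (ar_sub _ aQ1); comp_tac.
exists (fun c => Q (cpair (pi1 (pi1 c)) (pi2 c)) /\ ldrop (pi2 (pi1 c)) (pi1 (pi1 c)) = 0 /\
  forall i, i < pi1 (pi1 c) -> ldrop (pi2 (pi1 c)) i <> 0 /\
    N (cpair (lnth (pi2 (pi1 c)) i) (cpair i (pi2 c))) /\
    forall a, a < lnth (pi2 (pi1 c)) i -> ~ N (cpair a (cpair i (pi2 c)))); split.
- do 2!(apply: ar_and; first by ar_tac); apply: ar_ball; first by comp_tac.
  do 2!(apply: ar_and; first by ar_tac).
  apply: ar_ext (ar_sub (f := fun c => cpair (lnth (pi2 (pi1 (pi2 c))) (pi1 c)) (cpair (pi1 c) (pi2 (pi2 c)))) _ aN') _.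
    by comp_list_tac.
  by move=> c; rewrite !pi_cpairE.
- move=> x w w'; rewrite !pi_cpairE -[w]cpair_pi -[w']cpair_pi !pi_cpairE.
  move: (pi1 w) (pi2 w) (pi1 w') (pi2 w') => z l z' l' [Qz [l0 Hl]] [Qz' [l0' Hl']].
  (* If [z] and [z'] differed, the witness with the larger one would contain a refutation of [Q] at
     the smaller one. *)
  have ez : z = z'.
    case: (ltngtP z z') => // [/Hl'[_ [Nz _]]|/Hl[_ [Nz _]]].
      by have /nQ := ex_intro (fun a => N (cpair a (cpair z x))) _ Nz.
    by have /nQ := ex_intro (fun a => N (cpair a (cpair z' x))) _ Nz.
  subst z'; congr cpair.
  have [xs exs sxs] := size_of_ldrop l0 (fun i lt_i => (Hl i lt_i).1).
  have [ys eys sys] := size_of_ldrop l0' (fun i lt_i => (Hl' i lt_i).1).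
  rewrite exs eys; congr lc; apply: (@eq_from_nth _ 0); first by rewrite sxs sys.
  move=> i; rewrite sxs => lt_i; have [_ [Ni min_i]] := Hl i lt_i; have [_ [Ni' min_i']] := Hl' i lt_i.
  rewrite -!lnth_lc -exs -eys; case: (ltngtP (lnth l i) (lnth l' i)) => // [/min_i'|/min_i] //.
- move=> x; split=> [ex_z|[w [Qz _]]]; last by exists (pi1 w); move: Qz; rewrite !pi_cpairE.
  have [z [Qz min_z]] := least_ex ex_z.
  have /functional_choice[a Ha] : forall i, exists a, i < z -> N (cpair a (cpair i x)) /\
      forall b, N (cpair b (cpair i x)) -> a <= b.
    move=> i; case: (ltnP i z) => [lt_i|]; last by exists 0.
    have /nQ/least_ex[a Ha] : ~ Q (cpair i x) by move/min_z; rewrite leqNgt lt_i.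
    by exists a.
  exists (cpair z (lc (mkseq a z))); rewrite !pi_cpairE; split=> //.
  split; first by rewrite ldrop_lc drop_oversize ?size_mkseq.
  move=> i lt_i; rewrite ldrop_neq0 size_mkseq; split=> //.
  have [Ni min_i] := Ha i lt_i; rewrite lnth_lc nth_mkseq //; split=> // b lt_b /min_i.
  by rewrite leqNgt lt_b.
Qed.

(** Writing [P x] as: every [y] has a witness, made unique by [unique_witness], the valid lists are
    those giving the witnesses of an initial segment. There is at most one of each length, so they
    are infinite in number exactly when no [y] lacks a witness. *)
Lemma Pi_infinitely m P : ar m.+1.*2 false P -> exists Q, ar m.*2 false Q /\
  forall x, P x <-> infinitely (fun w => Q (cpair w x)).
Proof.
move=> [P1 [[P2 [aP2 HP1]] HP]].
have [Q [aQ Quniq Qex]] := unique_witness aP2.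
pose valid l x := forall i, i < l -> ldrop l i = 0 \/ Q (cpair (lnth l i) (cpair i x)).
have validP xs x : valid (lc xs) x <-> forall i, i < size xs -> Q (cpair (nth 0 xs i) (cpair i x)).
  split=> H i lt_i.
    rewrite -lnth_lc; case: (H i) => //; first exact: leq_trans lt_i (leq_size_lc _).
    by move/ldrop_neq0: lt_i.
  case: (ltnP i (size xs)) => [/H|le_i]; first by rewrite lnth_lc; right.
  by left; rewrite ldrop_lc drop_oversize.
exists (fun c => valid (pi1 c) (pi2 c)); split.
  rewrite /valid; ar_tac; apply: (ar_sub _ aQ); comp_list_tac.
move=> x; rewrite HP; split=> [H N|inf y].
  have /functional_choice[w Hw] : forall y, exists w, Q (cpair w (cpair y x)).
    by move=> y; apply/Qex/HP1; apply: H.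
  exists (lc (mkseq w N)); rewrite !pi_cpairE; split.
    by apply: leq_trans (leq_size_lc _); rewrite size_mkseq.
  by apply/validP => i; rewrite size_mkseq => lt_i; rewrite nth_mkseq.
apply/HP1/Qex; apply: NNPP => ny.
(* Valid lists of length at most [y] have bounded codes by uniqueness; a valid list with a larger
   code is therefore longer and contains a witness for [y]. *)
have [B HB] : exists B, forall xs, size xs <= y -> valid (lc xs) x -> lc xs <= B.
  elim: (y) => [|k [B HB]]; first by exists 0 => -[].
  have [[xs [sxs vxs]]|no] := classic (exists xs, size xs = k.+1 /\ valid (lc xs) x).
    exists (maxn B (lc xs)) => ys; rewrite leq_eqVlt => /orP[/eqP sys|lt_k] vys; last first.
      by rewrite leq_max HB.
    suff -> : ys = xs by rewrite leq_maxr.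
    apply: (@eq_from_nth _ 0); first by rewrite sxs sys.
    by move=> i lt_i; apply: Quniq; [apply: ((validP _ _).1 vys)|apply: ((validP _ _).1 vxs)]; rewrite // sxs -sys.
  exists B => ys; rewrite leq_eqVlt => /orP[/eqP sys|lt_k]; last exact: HB.
  by move=> vys; case: no; exists ys.
have [l [lt_l]] := inf B.+1; rewrite !pi_cpairE; have [xs e] := lc_surj l; rewrite {l}e in lt_l *.
move=> vxs; case: (leqP (size xs) y) => [le_y|lt_y]; first by have := HB _ le_y vxs; lia.
by apply: ny; exists (nth 0 xs y); apply: ((validP _ _).1 vxs).
Qed.

Fixpoint inf_quantifiers (R : nat -> Prop) (m x : nat) : Prop :=
  if m is m'.+1 then infinitely (fun w => inf_quantifiers R m' (cpair w x)) else R x.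

Lemma Pi_normal_form m P : ar m.*2 false P ->
  exists R, recp R /\ forall x, P x <-> inf_quantifiers R m x.
Proof.
elim: m P => [|m IH] P aP; first by exists P.
have [Q [/IH[R [rR HR]] HQ]] := Pi_infinitely aP; exists R; split=> // x.
by rewrite HQ; split=> H N; have [w [le_w Hw]] := H N; exists w; split=> //; apply/HR.
Qed.

(** * Trees coding nested infinity quantifiers *)

Lemma comp_if b f g : cfun b -> cfun f -> cfun g -> cfun (fun x => if b x == 0 then f x else g x).
Proof.
move=> cb cf cg.
apply: (@comp_ext (fun x => (1 - b x) * f x + (1 - (1 - b x)) * g x)); first by comp_tac.
by move=> x; case: (b x) => [|k] /=; nia.
Qed.

(* A state [cpair 0 x] asks for the tree of the statement [x]; a state [cpair 1 0] for the
   tree of true statements and [cpair 1 k.+1] for that of false statements with exactly [k]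
   instances. The child [cpair 0 w] is the instance [w]; the children [cpair j.+1 k] provide
   infinitely many copies of every tree of a false statement. *)
Definition child_state (s c : nat) : nat :=
  if pi1 c == 0 then
    if pi1 s == 0 then cpair 0 (cpair (pi2 c) (pi2 s))
    else if pi2 s == 0 then cpair 1 0
    else if (pi2 c).+2 - pi2 s == 0 then cpair 1 0 else cpair 1 1
  else cpair 1 (pi2 c).+1.

Lemma comp_child_state f g : cfun f -> cfun g -> cfun (fun x => child_state (f x) (g x)).
Proof.
move=> cf cg; rewrite /child_state; apply: comp_if; [by comp_tac| |by comp_tac].
by do 3!(apply: comp_if; [by comp_tac|by comp_tac|]); comp_tac.
Qed.

Section Coding.
Variable R : nat -> Prop.

(** At depth 0 a true statement is a single node and a false one the empty structure. Nodes of the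
    trees below are coded lists of child labels; only those of full length [m] depend on truth
    values. *)
Definition leaf_present (s : nat) : Prop :=
  (pi1 s = 0 /\ R (pi2 s)) \/ (pi1 s <> 0 /\ pi2 s = 0).

Fixpoint node (m s v : nat) : Prop :=
  if m is m'.+1 then v = 0 \/ (v <> 0 /\ node m' (child_state s (lhd v)) (ltl v))
  else v = 0 /\ leaf_present s.

Fixpoint prefix_le (m v v' : nat) : Prop :=
  if m is m'.+1 then v = 0 \/ (v <> 0 /\ v' <> 0 /\ lhd v = lhd v' /\ prefix_le m' (ltl v) (ltl v'))
  else v = 0.

Lemma recp_node m f g : recp R -> cfun f -> cfun g -> recp (fun x => node m (f x) (g x)).
Proof.
move=> rR; elim: m f g => [|m IH] f g cf cg.
  apply: (@ar_and 0 true); first by apply: recp_eq; comp_tac.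
  rewrite /leaf_present; apply: (@ar_or 0 true); apply: (@ar_and 0 true).
  - by apply: recp_eq; comp_tac.
  - by apply: (recp_sub rR); comp_tac.
  - by apply: recp_not; apply: recp_eq; comp_tac.
  - by apply: recp_eq; comp_tac.
apply: (@ar_or 0 true); first by apply: recp_eq; comp_tac.
apply: (@ar_and 0 true); first by apply: recp_not; apply: recp_eq; comp_tac.
by apply: IH; [apply: comp_child_state; comp_list_tac|comp_list_tac].
Qed.

Lemma recp_prefix_le m f g : cfun f -> cfun g -> recp (fun x => prefix_le m (f x) (g x)).
Proof.
elim: m f g => [|m IH] f g cf cg; first by apply: recp_eq; comp_tac.
apply: (@ar_or 0 true); first by apply: recp_eq; comp_tac.
do 2!(apply: (@ar_and 0 true); first by apply: recp_not; apply: recp_eq; comp_tac).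
apply: (@ar_and 0 true); first by apply: recp_eq; comp_list_tac.
by apply: IH; comp_list_tac.
Qed.

Lemma prefix_le_refl m v s : node m s v -> prefix_le m v v.
Proof.
elim: m s v => [|m IH] s v /=; first by case.
by case=> [->|[v0 /IH le_v]]; [left|right].
Qed.

Lemma lcons_eta v w : v <> 0 -> w <> 0 -> lhd v = lhd w -> ltl v = ltl w -> v = w.
Proof. by move=> /lcons_split-> /lcons_split->; rewrite !lhd_cons !ltl_cons => -> ->. Qed.

Lemma prefix_le_anti m v w : prefix_le m v w -> prefix_le m w v -> v = w.
Proof.
elim: m v w => [|m IH] v w /=; first by move=> -> ->.
move=> [->|[v0 [w0 [e le_vw]]]] [ew|[w0' [v0' [_ le_wv]]]] //.
by apply: lcons_eta => //; apply: IH.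
Qed.

Lemma prefix_le_trans m u v w : prefix_le m u v -> prefix_le m v w -> prefix_le m u w.
Proof.
elim: m u v w => [|m IH] u v w //=.
move=> [->|[u0 [v0 [e le_uv]]]]; first by left.
move=> [ev|[_ [w0 [e' le_vw]]]]; first by case: v0.
by right; split=> //; split=> //; split; [rewrite e|apply: IH le_vw].
Qed.

Lemma prefix_le_linear m u v w : prefix_le m u w -> prefix_le m v w -> prefix_le m u v \/ prefix_le m v u.
Proof.
elim: m u v w => [|m IH] u v w /=; first by move=> ->; left.
move=> [->|[u0 [w0 [e le_uw]]]]; first by left; left.
move=> [->|[v0 [_ [e' le_vw]]]]; first by right; left.
by have [le_uv|le_vu] := IH _ _ _ le_uw le_vw; [left|right]; right; rewrite e e'.
Qed.

Lemma prefix_finite m s v : node m s v -> exists t : seq nat, size t <= m /\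
  forall u, sprec (node m s) (prefix_le m) u v -> u \in t.
Proof.
elim: m s v => [|m IH] s v.
  by case=> -> _; exists [::]; split=> // u [[-> _] _ _ []].
case=> [->|[v0 /IH[t [st Ht]]]].
  by exists [::]; split=> // u [_ _ [e|[_ [ne _]]] ne']; [case: ne'|case: ne].
exists (0 :: map (lcons (lhd v)) t); split; first by rewrite /= size_map.
move=> u [[->|[u0 nu]] [e|[_ nv]] le_uv ne]; rewrite inE ?eqxx //.
case: le_uv => [e|[_ [_ [e le_uv]]]]; first by case: u0.
rewrite (lcons_split u0) e map_f ?orbT //; apply: Ht; split=> //; first by rewrite -e.
by move=> e'; apply: ne; apply: lcons_eta.
Qed.

Lemma node_root m s : 0 < m -> node m s 0. Proof. by case: m => // m _; left. Qed.

Lemma prefix_le0 m v : prefix_le m 0 v. Proof. by case: m => [|m] //=; left. Qed.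

Lemma node_tree m s : 0 < m -> tree_height_le m (node m s) (prefix_le m).
Proof.
move=> m_gt0; apply/tree_condP; split.
- split.
  + by move=> v; apply: prefix_le_refl.
  + by move=> v w _ _; apply: prefix_le_anti.
  + by move=> u v w _ _ _; apply: prefix_le_trans.
  + by move=> w u v _ _ _; apply: prefix_le_linear.
  + by move=> v /prefix_finite[t [st Ht]]; apply: enum_finite st Ht.
- by exists 0; apply: node_root.
- by move=> v w _ _; exists 0; split; [apply: node_root|split; apply: prefix_le0].
Qed.

Definition node_iso (m s s' : nat) : Prop :=
  iso_structures (node m s) (prefix_le m) (node m s') (prefix_le m).

Lemma node_isoS m s s' phi :
  (forall c c', phi c = phi c' -> c = c') -> (forall c', exists c, phi c = c') ->
  (forall c, node_iso m (child_state s c) (child_state s' (phi c))) -> node_iso m.+1 s s'.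
Proof.
move=> phi_inj phi_surj /functional_choice[g Hg].
pose f v := if v == 0 then 0 else lcons (phi (lhd v)) (g (lhd v) (ltl v)).
have f0 : f 0 = 0 by [].
have fS v : v <> 0 -> f v = lcons (phi (lhd v)) (g (lhd v) (ltl v)) by rewrite /f; case: eqP.
exists f; split=> [v [->|[v0 nv]]|v w [->|[v0 nv]] [->|[w0 nw]]|z [->|[z0 nz]]|v w [->|[v0 nv]] [->|[w0 nw]]];
  rewrite ?f0 ?(fS v) ?(fS w) //.
- by left.
- by right; rewrite lhd_cons ltl_cons; split=> //; have [H _ _ _] := Hg (lhd v); apply: H.
- move=> /lcons_inj[/phi_inj e eg]; apply: lcons_eta => //.
  have [_ H _ _] := Hg (lhd v); apply: H => //; [by rewrite e|by rewrite eg e].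
- by exists 0 => //; left.
- have [c ec] := phi_surj (lhd z); have [_ _ H _] := Hg c.
  have [|y ny ey] := H (ltl z); first by rewrite ec.
  exists (lcons c y); first by right; rewrite lhd_cons ltl_cons.
  by rewrite fS // lhd_cons ltl_cons ec ey -lcons_split.
- by split=> _; left.
- by split=> -[//|[_ []//]].
- have [_ _ _ H] := Hg (lhd v).
  split=> -[//|[_ [_ [e le_vw]]]]; right; do 2!split=> //.
    rewrite !lhd_cons !ltl_cons; split; first by rewrite e.
    by rewrite -e in nw *; apply/(H _ _ nv nw).
  move: e le_vw; rewrite !lhd_cons !ltl_cons => /phi_inj e; rewrite -e => le_vw; split=> //.
  by rewrite -e in nw; apply/(H _ _ nv nw).
Qed.

Lemma node0 m s v : node m s v -> node m s 0.
Proof. by case: m => [|m]; [case|left]. Qed.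

(** The condition on [0] restricts to labels that occur: for [m = 0] the child itself may be
    absent. *)
Lemma node_iso_children m s s' : node_iso m.+1 s s' -> exists psi : nat -> nat,
  (forall c, node m (child_state s c) 0 -> node_iso m (child_state s c) (child_state s' (psi c))) /\
  (forall c c', node m (child_state s c) 0 -> node m (child_state s c') 0 -> psi c = psi c' -> c = c').
Proof.
case=> f [fN finj fsurj fle].
have N0 t : node m.+1 t 0 by left.
have f0 : f 0 = 0.
  have [z Nz ez] := fsurj 0 (N0 s').
  apply: (@prefix_le_anti m.+1); last exact: prefix_le0.
  by rewrite -[X in prefix_le _ _ X]ez; apply/(fle _ _ (N0 s) Nz); apply: prefix_le0.
have Nc t c v : node m.+1 t (lcons c v) <-> node m (child_state t c) v.
  split=> [[//|[_]]|nv]; first by rewrite lhd_cons ltl_cons.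
  by right; rewrite lhd_cons ltl_cons.
have lec c v c' v' : prefix_le m.+1 (lcons c v) (lcons c' v') <-> c = c' /\ prefix_le m v v'.
  split=> [[//|[_ [_]]]|[-> le_v]]; first by rewrite !lhd_cons !ltl_cons.
  by right; rewrite !lhd_cons !ltl_cons.
exists (fun c => lhd (f (lcons c 0))).
(* The image of a child is a child: the preimage of the one-letter prefix of that image is a
   nonempty prefix of [lcons c 0], hence equal to it. *)
have fc c : node m (child_state s c) 0 ->
    f (lcons c 0) = lcons (lhd (f (lcons c 0))) 0 /\ node m (child_state s' (lhd (f (lcons c 0)))) 0.
  move=> /Nc nc; have fn0 : f (lcons c 0) <> 0.
    by move=> e; have := finj _ _ nc (N0 s); rewrite f0 => /(_ e).
  have [//|[_ /node0 n0]] := fN _ nc; split=> //.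
  have /fsurj[u nu eu] := (Nc s' _ _).2 n0.
  have u0 : u <> 0 by move=> u0; move: eu; rewrite u0 f0.
  rewrite -eu; congr f; rewrite (lcons_split u0).
  have : prefix_le m.+1 u (lcons c 0).
    apply/(fle _ _ nu nc); rewrite eu [X in prefix_le _ _ X](lcons_split fn0).
    by apply/lec; split=> //; apply: prefix_le0.
  rewrite {1}(lcons_split u0) => /lec[-> le_u0].
  by congr lcons; apply: (@prefix_le_anti m) => //; apply: prefix_le0.
split=> [c nc|c c' nc nc' e]; last first.
  have [e1 _] := fc c nc; have [e2 _] := fc c' nc'.
  have ef : f (lcons c 0) = f (lcons c' 0) by rewrite e1 e2 e.
  by have /lcons_inj[] := finj _ _ ((Nc _ _ _).2 nc) ((Nc _ _ _).2 nc') ef.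
have [efc nfc] := fc c nc; set c' := lhd _ in efc nfc *.
have fcv v : node m (child_state s c) v ->
    f (lcons c v) = lcons c' (ltl (f (lcons c v))).
  move=> nv; have fn0 : f (lcons c v) <> 0.
    by move=> e; have := finj _ _ ((Nc _ _ _).2 nv) (N0 s); rewrite f0 => /(_ e).
  have : prefix_le m.+1 (f (lcons c 0)) (f (lcons c v)).
    apply/(fle _ _ ((Nc _ _ _).2 nc) ((Nc _ _ _).2 nv)); apply/lec; split=> //; exact: prefix_le0.
  by rewrite efc {1 2}(lcons_split fn0) => /lec[-> _].
exists (fun v => ltl (f (lcons c v))); split.
- by move=> v nv; apply/(Nc s'); rewrite -fcv //; apply/fN/Nc.
- move=> v w nv nw e; have ef : f (lcons c v) = f (lcons c w) by rewrite (fcv v) // (fcv w) // e.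
  by have /lcons_inj[] := finj _ _ ((Nc _ _ _).2 nv) ((Nc _ _ _).2 nw) ef.
- move=> z nz; have [u nu eu] := fsurj _ ((Nc _ _ _).2 nz).
  have : prefix_le m.+1 (lcons c 0) u.
    by apply/(fle _ _ ((Nc _ _ _).2 nc) nu); rewrite efc eu; apply/lec; split=> //; exact: prefix_le0.
  case=> [//|[_ [u0 [+ _]]]]; rewrite lhd_cons => ec.
  have eu' : u = lcons c (ltl u) by rewrite ec -lcons_split.
  exists (ltl u); first by apply/(Nc s); rewrite -eu'.
  by rewrite -eu' eu ltl_cons.
- move=> v w nv nw; transitivity (prefix_le m.+1 (lcons c v) (lcons c w)).
    by rewrite lec; split=> [|[]].
  rewrite (fle _ _ ((Nc _ _ _).2 nv) ((Nc _ _ _).2 nw)) (fcv v) // (fcv w) // lec ltl_cons ltl_cons.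
  by split=> [[]|].
Qed.
End Coding.

(** * Isomorphism types of the coding trees *)

Lemma infinitely_has_many A k : infinitely A -> has_many k A.
Proof.
have [b Hb] := bool_decision A => inf.
apply: (@has_many_sub k (fun i => b i)) => [u /Hb//|]; apply/has_many_rank.
elim: k => [|k [n le_k]]; first by exists 0.
have [w [le_w /Hb bw]] := inf n; exists w.+1; rewrite rankS bw.
by have := leq_rank b le_w; lia.
Qed.

Lemma finite_count A : ~ infinitely A -> exists k, forall k', has_many k' A <-> k' <= k.
Proof.
have [b Hb] := bool_decision A => /not_all_ex_not[N no].
have bN w : b w -> w < N.
  by move=> /Hb Aw; rewrite ltnNge; apply/negP => le_N; apply: no; exists w.
have rN n : rank b n <= rank b N.
  case: (leqP n N) => [/leq_rank//|/ltnW/subnKC <-]; elim: (n - N) => [|d IH]; first by rewrite addn0.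
  rewrite addnS rankS; case bd: (b (N + d)); last by rewrite addn0.
  by have := bN _ bd; lia.
exists (rank b N) => k'; split=> [h|le_k].
  have /has_many_rank[n le_k] : has_many k' b by apply: has_many_sub h => u /Hb.
  exact: leq_trans le_k (rN n).
apply: (@has_many_sub k' (fun i => b i)) => [u /Hb//|]; apply/has_many_rank; by exists N.
Qed.

Section CodingTrees.
Variable R : nat -> Prop.

Notation niso := (node_iso R).

Lemma node_iso_sym m s s' : niso m s s' -> niso m s' s.
Proof. exact: iso_sym. Qed.

Lemma node_iso_trans m s s' s'' : niso m s s' -> niso m s' s'' -> niso m s s''.
Proof. exact: iso_trans. Qed.

(** All children [cpair 0 w] of the true tree are true. By induction they must go to true children
    of the other tree, of which there are only the [k] labels [cpair 0 w] with [w < k]. *)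
Lemma true_false_not_iso m k : ~ niso m (cpair 1 0) (cpair 1 k.+1).
Proof.
elim: m k => [|m IH] k.
  case=> f [fN _ _ _]; have [|_] := fN 0; first by split=> //; right; rewrite !pi_cpairE.
  by case=> [[]|[]]; rewrite !pi_cpairE.
move=> /node_iso_children[psi [Hpsi psi_inj]].
have st w : child_state (cpair 1 0) (cpair 0 w) = cpair 1 0 by rewrite /child_state !pi_cpairE.
have n0 w : node R m (child_state (cpair 1 0) (cpair 0 w)) 0.
  rewrite st; case: m {IH Hpsi psi_inj} => [|m]; last by left.
  by split=> //; right; rewrite !pi_cpairE.
have psi_w w : psi (cpair 0 w) \in mkseq (cpair 0) k.
  have := Hpsi _ (n0 w); rewrite st /child_state; set c := psi _; case: eqP => [e0|_ /IH//].
  rewrite !pi_cpairE /=; case: eqP => [le_k _|_ /IH//].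
  apply/mapP; exists (pi2 c); first by rewrite mem_iota; lia.
  by rewrite -e0 cpair_pi.
apply: (@enum_finite k (fun c => c \in mkseq (cpair 0) k) (mkseq (cpair 0) k)) => //.
  by rewrite size_mkseq.
exists (fun w => psi (cpair 0 w)) => w _; split=> [//|w' lt_w] /(psi_inj _ _ (n0 w') (n0 w))/cpair_inj[_ e].
by move: lt_w; rewrite e ltnn.
Qed.

Lemma coding_tree m x :
  (inf_quantifiers R m x -> niso m (cpair 0 x) (cpair 1 0)) /\
  (~ inf_quantifiers R m x -> exists k, niso m (cpair 0 x) (cpair 1 k.+1)).
Proof.
elim: m x => [|m IH] x.
  have leaf s : node R 0 s 0 <-> leaf_present R s by split=> [[]|].
  split=> Rx; [|exists 0]; exists id; split=> //.
  - by move=> v [-> _]; apply/leaf; right; rewrite !pi_cpairE.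
  - by move=> v [-> _]; exists 0 => //; apply/leaf; left; rewrite !pi_cpairE.
  - by move=> v [_ [[_]|[]]]; rewrite !pi_cpairE.
  - by move=> v [_ [[]|[]]]; rewrite !pi_cpairE.
(* The colour of a state names a tree [cpair 1 z] isomorphic to its own: 0 for true, a positive
   number for false. Equal colours thus give isomorphic trees. The value 0 at other tags is a mere
   default. *)
have /functional_choice[col Hcol] : forall s, exists z, pi1 s <= 1 ->
    [/\ niso m s (cpair 1 z), pi1 s = 0 -> (z = 0 <-> inf_quantifiers R m (pi2 s)) &
      pi1 s = 1 -> z = pi2 s].
  move=> s; rewrite -[s]cpair_pi !pi_cpairE; case: (pi1 s) => [|[|i]]; last by exists 0.
    have [H1 H2] := IH (pi2 s); have [Q|nQ] := classic (inf_quantifiers R m (pi2 s)).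
      by exists 0 => _; split=> //; apply: H1.
    by have [k Hk] := H2 nQ; exists k.+1 => _; split.
  by exists (pi2 s) => _; split=> //; exists id; split=> // z; exists z.
have pi1_st s c : pi1 (child_state s c) <= 1.
  by rewrite /child_state; do !case: ifP => _; rewrite pi_cpairE.
have dummy s j k : col (child_state s (cpair j.+1 k)) = k.+1.
  have [_ _ ->] := Hcol _ (pi1_st s (cpair j.+1 k)); by rewrite /child_state !pi_cpairE.
have dummies s z k : has_many k (fun c => True /\ col (child_state s c) = z.+1).
  exists (fun j => cpair j.+1 z) => j _; split=> [|j' lt_j /cpair_inj[] e _]; first by rewrite dummy.
  by move: lt_j e; lia.
(* Every positive colour occurs infinitely often among the children of any state, by [dummies];
   hence agreement on the number of children of colour 0 already yields a matching. *)
have match_iso s s' :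
    (forall k, has_many k (fun w => col (child_state s (cpair 0 w)) = 0) <->
               has_many k (fun w => col (child_state s' (cpair 0 w)) = 0)) -> niso m.+1 s s'.
  move=> H.
  have count0 t k : has_many k (fun c => True /\ col (child_state t c) = 0) <->
      has_many k (fun w => col (child_state t (cpair 0 w)) = 0).
    have real c : col (child_state t c) = 0 -> c = cpair 0 (pi2 c).
      by rewrite -{1 2}[c]cpair_pi; case: (pi1 c) => // j; rewrite dummy.
    split; [apply: (has_many_map (f := pi2))|apply: (has_many_map (f := cpair 0))].
    - by move=> c [_ c0]; rewrite -real.
    - by move=> c c' [_ /real->] [_ /real->]; rewrite !pi_cpairE => ->.
    - by [].
    - by move=> w w' _ _ /cpair_inj[].
  have [[|z] k|phi [Hphi phi_inj phi_surj]] :=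
    @colour_matching (fun=> True) (fun=> True) (fun c => col (child_state s c)) (fun c => col (child_state s' c)).
  - by rewrite !count0.
  - by split=> _; apply: dummies.
  apply: (node_isoS (phi := phi)) => [c c'|c'|c]; first exact: phi_inj.
    by have [c _ e] := phi_surj c' Logic.I; exists c.
  have [_ e] := Hphi c Logic.I.
  have [iso1 _ _] := Hcol _ (pi1_st s c); have [iso2 _ _] := Hcol _ (pi1_st s' (phi c)).
  by apply: node_iso_trans iso1 _; rewrite -e; apply: node_iso_sym.
have col_real w : col (child_state (cpair 0 x) (cpair 0 w)) = 0 <-> inf_quantifiers R m (cpair w x).
  have [_ H _] := Hcol _ (pi1_st (cpair 0 x) (cpair 0 w)).
  by move: H; rewrite /child_state !pi_cpairE /= => /(_ erefl).
have col_fixed z w : col (child_state (cpair 1 z) (cpair 0 w)) = 0 <-> z = 0 \/ w.+1 < z.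
  have [_ _ H] := Hcol _ (pi1_st (cpair 1 z) (cpair 0 w)).
  move: H; rewrite /child_state !pi_cpairE /=.
  case: eqP => [->|z0]; first by rewrite !pi_cpairE => -> //; split=> // _; left.
  case: eqP => le_z; rewrite !pi_cpairE => -> //; split=> //; first by right; lia.
  by case=> // lt_z; case: le_z; lia.
split=> Q.
  apply: match_iso => k; split=> _.
    apply: infinitely_has_many => N; exists N; split=> //; apply/col_fixed; by left.
  apply: infinitely_has_many => N; have [w [le_w Qw]] := Q N.
  by exists w; split=> //; apply/col_real.
(* [k] is the number of true instances of the false statement; [cpair 1 k.+1] has exactly the true
   children [w < k]. *)
have [k Hk] := finite_count Q; exists k; apply: match_iso => k'.
transitivity (k' <= k).
  rewrite -Hk; split; apply: has_many_sub => w /col_real //.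
split=> [le_k|h].
  exists id => w lt_w; split; last by move=> w' lt_w'; lia.
  by apply/col_fixed; right; rewrite ltnS; apply: leq_trans le_k.
rewrite leqNgt; apply/negP => lt_k.
apply: (@enum_finite k (fun w => w < k) (iota 0 k)); first by rewrite size_iota.
  by move=> w; rewrite mem_iota.
by apply: has_many_leq lt_k _; apply: has_many_sub h => w /col_fixed[].
Qed.

Lemma coding_tree_iff m x : inf_quantifiers R m x <-> niso m (cpair 0 x) (cpair 1 0).
Proof.
have [H1 H2] := coding_tree m x; split=> // iso; apply: NNPP => /H2[k isok].
by apply: (@true_false_not_iso m k); apply: node_iso_trans (node_iso_sym iso) isok.
Qed.
End CodingTrees.

(** * The many-one reduction *)

Lemma recp_decider P : recp P -> exists b : nat -> nat, cfun b /\ forall x, (P x /\ b x = 1) \/ (~ P x /\ b x = 0).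
Proof.
move=> [f [cf Hf]]; exists (fun x => 1 - f x); split=> [|x]; first by comp_tac.
by rewrite Hf; case: (f x) => [|k]; [left|right].
Qed.

Lemma decides1_unique p P P' : decides1 p P -> decides1 p P' -> P = P'.
Proof.
move=> H H'; apply: functional_extensionality => x; apply: propositional_extensionality.
by have [[? e]|[? e]] := H x; have [[? e']|[? e']] := H' x; split=> // _; have := eval_fun e e'.
Qed.

Lemma decides2_unique p P P' : decides2 p P -> decides2 p P' -> P = P'.
Proof.
move=> H H'; apply: functional_extensionality => x; apply: functional_extensionality => y.
apply: propositional_extensionality.
by have [[? e]|[? e]] := H x y; have [[? e']|[? e']] := H' x y; split=> // _; have := eval_fun e e'.
Qed.

(** Both structures share one program for the order. Only the domain is specialised, to the state of
    the given statement and to that of true statements. *)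
Lemma Pi_reducible n B : 0 < n -> ar n.*2 false B -> m_reducible B (IsoTreeProblem n).
Proof.
move=> n_gt0 /Pi_normal_form[R [rR HB]].
have [b [cb Hb]] : exists b : nat -> nat, cfun b /\
    forall c, (node R n (pi1 c) (pi2 c) /\ b c = 1) \/ (~ node R n (pi1 c) (pi2 c) /\ b c = 0).
  by apply: recp_decider; apply: recp_node => //; comp_tac.
have [l [cl Hl]] : exists l : nat -> nat, cfun l /\
    forall c, (prefix_le n (pi1 c) (pi2 c) /\ l c = 1) \/ (~ prefix_le n (pi1 c) (pi2 c) /\ l c = 0).
  by apply: recp_decider; apply: recp_prefix_le; comp_tac.
have [p Hp] : comp2 (fun s v => b (cpair s v)).
  by apply/comp_uncurry; apply: (comp_comp cb); comp_tac.
have [q Hq] : comp2 (fun v w => l (cpair v w)).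
  by apply/comp_uncurry; apply: (comp_comp cl); comp_tac.
have [f [cf Hf]] := spec_prog_computable p.
have pq : prog (pickle q) = Some q by apply: pickleK.
have dec s : decides1 (spec_prog p s) (node R n s).
  move=> v; have := eval_spec_prog (Hp s v).
  by case: (Hb (cpair s v)); rewrite !pi_cpairE => -[Hn ->] ev; [left|right].
have decq : decides2 q (prefix_le n).
  move=> v w; have := Hq v w.
  by case: (Hl (cpair v w)); rewrite !pi_cpairE => -[Hn ->] ev; [left|right].
exists (fun x => cpair (cpair (f (cpair 0 x)) (pickle q)) (cpair (f (cpair 1 0)) (pickle q))); split.
  by comp_tac; apply: comp_cpair (comp_const 0) comp_id.
move=> x; rewrite HB coding_tree_iff; split=> [iso|].
  exists (f (cpair 0 x)), (pickle q), (f (cpair 1 0)), (pickle q).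
  exists (spec_prog p (cpair 0 x)), q, (spec_prog p (cpair 1 0)), q.
  exists (node R n (cpair 0 x)), (node R n (cpair 1 0)), (prefix_le n), (prefix_le n).
  split; first by [].
  do 2!(split; first exact: Hf; split; first exact: pq).
  do 2!(split; first exact: dec; split; first exact: decq).
  by do 2!(split; first exact: node_tree).
case=> a1 [b1 [a2 [b2 [d1 [r1 [d2 [r2 [D1 [D2 [le1 [le2]]]]]]]]]]].
move=> [/cpair_inj[/cpair_inj[<- <-] /cpair_inj[<- <-]]].
rewrite !Hf !pq => -[[<-] [[<-] [[<-] [[<-] [dD1 [dle1 [dD2 [dle2 [_ [_ iso]]]]]]]]]].
(* The problem only asserts an isomorphism of some sets decided by these programs; by uniqueness
   they are the coding trees. *)
rewrite /node_iso (decides1_unique (dec _) dD1) (decides1_unique (dec _) dD2).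
by move: iso; rewrite -(decides2_unique decq dle1) -(decides2_unique decq dle2).
Qed.

Theorem theorem4 (n : nat) : 1 <= n -> Pi0_complete (2 * n) (IsoTreeProblem n).
Proof.
move=> n_gt0; split; first exact: Pi0_IsoTreeProblem.
by move=> B /Pi0_setP; rewrite mul2n; apply: Pi_reducible.
Qed.
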